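(* Let $k$ be a field, let $\mathcal C$ be a small $k$-linear semigroupal category and let $\mathcal C^{\mathrm u}$ be a unitalization of $\mathcal C$. Assume that $\mathcal C$ is semigroupally equivalent to a strict skeletal semigroupal category. Then for all $n\ge 1$ the linear map $H^n_{\mathrm{DY}}(\mathcal C^{\mathrm u})\to H^n_{\mathrm{DY}}(\mathcal C)$ induced by the inclusion $\iota:\mathcal C\hookrightarrow\mathcal C^{\mathrm u}$ (that is, by restricting cochains to objects of $\mathcal C$) is an isomorphism.
   Context: Semigroupal notions. A semigroupal category is a category $\mathcal C$ with a bifunctor $\otimes:\mathcal C\times\mathcal C\to\mathcal C$ and a natural associator isomorphism satisfying the pentagon axiom (no unit is required). It is monoidal if there are an object $\mathbb 1$ and an isomorphism $\mathbb 1\otimes\mathbb 1\cong\mathbb 1$ such that $-\otimes\mathbb 1$ and $\mathbb 1\otimes-$ are equivalences. A semigroupal functor is a functor $F$ with a natural isomorphism $\Phi_{XY}:F(X)\otimes F(Y)\to F(X\otimes Y)$ satisfying the usual hexagon axiom. A semigroupal category is $k$-linear if $\mathcal C$ and all functors $X\otimes-$, $-\otimes X$ are $k$-linear; a semigroupal functor is $k$-linear if its underlying functor is. Strict means that the associators, respectively $\Phi$, are identities. A category is skeletal if isomorphic objects are equal. Unitalization. A $k$-linear monoidal category $\mathcal C^{\mathrm u}$ with unit object $\mathbb 1$ is a unitalization of $\mathcal C$ if $\mathcal C\subseteq\mathcal C^{\mathrm u}$ is the full semigroupal subcategory of objects not isomorphic to $\mathbb 1$, and $\mathrm{Hom}_{\mathcal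 C^{\mathrm u}}(\mathbb 1,X)=\{0\}=\mathrm{Hom}_{\mathcal C^{\mathrm u}}(X,\mathbb 1)$ for all $X\in\mathcal C$. Davydov-Yetter (DY) cohomology. For a strict $k$-linear semigroupal category $\mathcal C$ and $n\ge1$, let $C^n_{\mathrm{DY}}(\mathcal C)$ be the vector space of natural endomorphisms of the functor $\mathcal C^{\times n}\to\mathcal C$, $(X_1,\dots,X_n)\mapsto X_1\otimes\cdots\otimes X_n$. Define $\partial_i^n:C^n_{\mathrm{DY}}(\mathcal C)\to C^{n+1}_{\mathrm{DY}}(\mathcal C)$ for $0\le i\le n+1$ by: $\partial^n_0(\eta)_{X_0,\dots,X_n}=\mathrm{id}_{X_0}\otimes\eta_{X_1,\dots,X_n}$; $\partial^n_i(\eta)_{X_0,\dots,X_n}=\eta_{X_0,\dots,X_{i-2},X_{i-1}\otimes X_i,X_{i+1},\dots,X_n}$ for $1\le i\le n$; $\partial^n_{n+1}(\eta)_{X_0,\dots,X_n}=\eta_{X_0,\dots,X_{n-1}}\otimes\mathrm{id}_{X_n}$. The DY complex is concentrated in degrees $\ge1$ (so $H^1_{\mathrm{DY}}=\ker d^1$) with differential $d^n=\sum_{i=0}^{n+1}(-1)^i\partial^n_i$; its cohomology is $H^\bullet_{\mathrm{DY}}(\mathcal C)$. In the non-strict case, $C^n_{\mathrm{DY}}(\mathcal C)$ is the space of natural transformations from $(\cdots(X_1\otimes X_2)\otimes\cdots)\otimes X_n$ to $X_1\otimes(\cdots\otimes(X_{n-1}\otimes X_n)\cdots)$, and the same formulas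 for $\partial_i^n$ are used after pre- and postcomposing with the (unique, by coherence) composites of associators needed to give the result this source and target. *)

(* Defs.v *)
From HB Require Import structures.
From mathcomp Require Import all_boot all_order all_algebra.
From mathcomp Require Import ring_quotient boolp.

Set Implicit Arguments.
Unset Strict Implicit.
Unset Printing Implicit Defensive.

Import GRing.Theory.
Local Open Scope ring_scope.

Reserved Notation "g \c f" (at level 50, left associativity).
Reserved Notation "X \ox Y" (at level 40, left associativity).
Reserved Notation "f \om g" (at level 40, left associativity).

Record category := Category {
  obj :> Type;
  hom : obj -> obj -> Type;
  idm : forall X, hom X X;
  comp : forall X Y Z, hom Y Z -> hom X Y -> hom X Z;
  comp1m : forall X Y (f : hom X Y), comp (idm Y) f = f;
  compm1 : forall X Y (f : hom X Y), comp f (idm X) = f;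
  compA : forall X Y Z W (h : hom Z W) (g : hom Y Z) (f : hom X Y),
    comp h (comp g f) = comp (comp h g) f
}.
Arguments hom {c} X Y : rename.
Arguments idm {c} X : rename.
Arguments comp {c X Y Z} g f : rename.
Notation "g \c f" := (comp g f).

Definition eq_hom (C : category) (X Y : C) (e : X = Y) : hom X Y :=
  match e with erefl => idm X end.

Definition is_iso (C : category) (X Y : C) (f : hom X Y) : Prop :=
  exists g : hom Y X, g \c f = idm X /\ f \c g = idm Y.

Definition isomorphic (C : category) (X Y : C) : Prop :=
  exists f : hom X Y, is_iso f.

Definition skeletal (C : category) : Prop :=
  forall X Y : C, isomorphic X Y -> X = Y.

Record functor (C D : category) := Functor {
  fobj :> C -> D;
  fmap : forall X Y : C, hom X Y -> hom (fobj X) (fobj Y);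
  fmap1 : forall X, fmap (idm X) = idm (fobj X);
  fmapM : forall X Y Z (g : hom Y Z) (f : hom X Y),
    fmap (g \c f) = fmap g \c fmap f
}.
Arguments fmap {C D} F {X Y} f : rename.

Definition idF (C : category) : functor C C :=
  @Functor C C id (fun _ _ => id) (fun _ => erefl) (fun _ _ _ _ _ => erefl).

Program Definition compF (C D E : category) (G : functor D E)
    (F : functor C D) : functor C E :=
  @Functor C E (G \o F) (fun _ _ f => fmap G (fmap F f)) _ _.
Next Obligation. by move=> *; rewrite /= !fmap1. Qed.
Next Obligation. by move=> *; rewrite /= !fmapM. Qed.

Definition natiso (C D : category) (F G : functor C D) : Prop :=
  exists e : forall X, hom (F X) (G X),
    (forall X, is_iso (e X)) /\
    (forall X Y (f : hom X Y), e Y \c fmap F f = fmap G f \c e X).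

Definition is_equivalence (C D : category) (F : functor C D) : Prop :=
  exists G : functor D C, natiso (compF G F) (idF C) /\ natiso (compF F G) (idF D).

Definition fully_faithful (C D : category) (F : functor C D) : Prop :=
  forall X Y : C, bijective (@fmap C D F X Y).

Record semigroupal := Semigroupal {
  sgcat :> category;
  ten : sgcat -> sgcat -> sgcat;
  tenm : forall X X' Y Y' : sgcat,
    hom X X' -> hom Y Y' -> hom (ten X Y) (ten X' Y');
  tenm1 : forall X Y, tenm (idm X) (idm Y) = idm (ten X Y);
  tenmM : forall X X' X'' Y Y' Y'' (f' : hom X' X'') (f : hom X X')
    (g' : hom Y' Y'') (g : hom Y Y'),
    tenm (f' \c f) (g' \c g) = tenm f' g' \c tenm f g;
  assoc : forall X Y Z, hom (ten (ten X Y) Z) (ten X (ten Y Z));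
  associ : forall X Y Z, hom (ten X (ten Y Z)) (ten (ten X Y) Z);
  assocK : forall X Y Z, associ X Y Z \c assoc X Y Z = idm _;
  associK : forall X Y Z, assoc X Y Z \c associ X Y Z = idm _;
  assoc_nat : forall X X' Y Y' Z Z'
    (f : hom X X') (g : hom Y Y') (h : hom Z Z'),
    assoc X' Y' Z' \c tenm (tenm f g) h = tenm f (tenm g h) \c assoc X Y Z;
  pentagon : forall X Y Z W,
    assoc X Y (ten Z W) \c assoc (ten X Y) Z W =
    tenm (idm X) (assoc Y Z W) \c assoc X (ten Y Z) W
      \c tenm (assoc X Y Z) (idm W)
}.
Arguments ten {s} X Y : rename.
Arguments tenm {s X X' Y Y'} f g : rename.
Arguments assoc {s} X Y Z : rename.
Arguments associ {s} X Y Z : rename.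
Notation "X \ox Y" := (ten X Y).
Notation "f \om g" := (tenm f g).

Definition strict (C : semigroupal) : Prop :=
  forall X Y Z : C,
    exists e : (X \ox Y) \ox Z = X \ox (Y \ox Z), assoc X Y Z = eq_hom e.

Program Definition ltenF (C : semigroupal) (A : C) : functor C C :=
  @Functor C C (fun X => A \ox X) (fun _ _ f => idm A \om f) _ _.
Next Obligation. by move=> *; rewrite /= tenm1. Qed.
Next Obligation. by move=> *; rewrite /= -tenmM comp1m. Qed.

Program Definition rtenF (C : semigroupal) (A : C) : functor C C :=
  @Functor C C (fun X => X \ox A) (fun _ _ f => f \om idm A) _ _.
Next Obligation. by move=> *; rewrite /= tenm1. Qed.
Next Obligation. by move=> *; rewrite /= -tenmM comp1m. Qed.

Definition is_unit (C : semigroupal) (I : C) : Prop :=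
  [/\ isomorphic (I \ox I) I, is_equivalence (rtenF I)
    & is_equivalence (ltenF I)].

Record sgfunctor (C D : semigroupal) := SgFunctor {
  sgfun :> functor C D;
  sgm : forall X Y, hom (sgfun X \ox sgfun Y) (sgfun (X \ox Y));
  sgmi : forall X Y, hom (sgfun (X \ox Y)) (sgfun X \ox sgfun Y);
  sgmK : forall X Y, sgmi X Y \c sgm X Y = idm _;
  sgmiK : forall X Y, sgm X Y \c sgmi X Y = idm _;
  sgm_nat : forall X X' Y Y' (f : hom X X') (g : hom Y Y'),
    sgm X' Y' \c (fmap sgfun f \om fmap sgfun g) =
    fmap sgfun (f \om g) \c sgm X Y;
  hexagon : forall X Y Z,
    fmap sgfun (assoc X Y Z) \c sgm (X \ox Y) Z \c (sgm X Y \om idm (sgfun Z)) =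
    sgm X (Y \ox Z) \c (idm (sgfun X) \om sgm Y Z)
      \c assoc (sgfun X) (sgfun Y) (sgfun Z)
}.
Arguments sgm {C D} F X Y : rename.
Arguments sgmi {C D} F X Y : rename.

Definition strict_sgfunctor (C D : semigroupal) (F : sgfunctor C D) : Prop :=
  forall X Y : C, exists e : F X \ox F Y = F (X \ox Y), sgm F X Y = eq_hom e.

Definition equiv_to_strict_skeletal (C : semigroupal) : Prop :=
  exists D : semigroupal, [/\ strict D, skeletal D
    & exists F : sgfunctor C D, is_equivalence F].

Definition lhom (k : fieldType) (C : category)
    (m : forall X Y : C, GRing.Lmodule k (hom X Y)) (X Y : C) : lmodType k :=
  GRing.Lmodule.Pack (m X Y).

(* The class [GRing.Lmodule] also bundles a choice structure on the hom-sets,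
   which every type has classically. *)
Record linear_structure (k : fieldType) (C : category) := LinearStructure {
  hom_lmod :> forall X Y : C, GRing.Lmodule k (hom X Y);
  comp_linearl : forall (X Y Z : C) (f : hom X Y),
    linear (fun g : lhom hom_lmod Y Z => (g \c f : lhom hom_lmod X Z));
  comp_linearr : forall (X Y Z : C) (g : hom Y Z),
    linear (fun f : lhom hom_lmod X Y => (g \c f : lhom hom_lmod X Z))
}.

Record ksemigroupal (k : fieldType) := KSemigroupal {
  ksg :> semigroupal;
  klin : linear_structure k ksg;
  ten_linearl : forall X Y A : ksg,
    linear (fun f : lhom klin X Y =>
              (f \om idm A : lhom klin (X \ox A) (Y \ox A)));
  ten_linearr : forall X Y A : ksg,
    linear (fun f : lhom klin X Y =>
              (idm A \om f : lhom klin (A \ox X) (A \ox Y)))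
}.

HB.instance Definition _ (k : fieldType) (C : ksemigroupal k) (X Y : C) :
  GRing.Lmodule k (hom X Y) := klin C X Y.

Definition klinear_functor (k : fieldType) (C D : ksemigroupal k)
    (F : functor C D) : Prop :=
  forall X Y : C, linear (fun f : hom X Y => fmap F f).

(* [C] is given as a category of its own; being a full semigroupal
   subcategory of [ucat] is expressed by a strict semigroupal functor that is
   injective on objects and fully faithful. *)
Record unitalization (k : fieldType) (C : ksemigroupal k) := Unitalization {
  ucat :> ksemigroupal k;
  uone : ucat;
  uone_unit : is_unit uone;
  uincl : sgfunctor C ucat;
  uincl_linear : klinear_functor uincl;
  uincl_strict : strict_sgfunctor uincl;
  uincl_inj : injective uincl;
  uincl_ff : fully_faithful uincl;
  uincl_image : forall Y : ucat,
    (exists X : C, uincl X = Y) <-> ~ isomorphic Y uone;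
  uone_hom0l : forall (X : C) (f : hom uone (uincl X)), f = 0;
  uone_hom0r : forall (X : C) (f : hom (uincl X) uone), f = 0
}.

(* The product category C^n, with C^(n+1) = C * C^n. *)
Fixpoint pow (C : category) (n : nat) : Type :=
  if n is m.+1 then (C * pow C m)%type else unit.

Fixpoint phom (C : category) (n : nat) : pow C n -> pow C n -> Type :=
  match n with
  | 0 => fun _ _ => unit
  | m.+1 => fun s t => (hom s.1 t.1 * phom s.2 t.2)%type
  end.

Section Tensors.
Variable C : semigroupal.
Implicit Types n i : nat.

(* (..(X_0 (x) X_1) (x) ..) (x) X_n *)
Fixpoint tenL n : pow C n.+1 -> C :=
  match n with
  | 0 => fun s => s.1
  | m.+1 => fun s => @tenL m (s.1 \ox s.2.1, s.2.2)
  end.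

(* X_0 (x) (.. (x) (X_(n-1) (x) X_n)..) *)
Fixpoint tenR n : pow C n.+1 -> C :=
  match n with
  | 0 => fun s => s.1
  | m.+1 => fun s => s.1 \ox @tenR m s.2
  end.

Fixpoint tenLm n : forall s t : pow C n.+1, phom s t -> hom (tenL s) (tenL t) :=
  match n with
  | 0 => fun _ _ f => f.1
  | m.+1 => fun s t f =>
      @tenLm m (s.1 \ox s.2.1, s.2.2) (t.1 \ox t.2.1, t.2.2)
        (f.1 \om f.2.1, f.2.2)
  end.

Fixpoint tenRm n : forall s t : pow C n.+1, phom s t -> hom (tenR s) (tenR t) :=
  match n with
  | 0 => fun _ _ f => f.1
  | m.+1 => fun s t f => f.1 \om @tenRm m s.2 t.2 f.2
  end.

Fixpoint pid n : forall s : pow C n, phom s s :=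
  match n with
  | 0 => fun _ => tt
  | m.+1 => fun s => (idm s.1, @pid m s.2)
  end.

(* (X_0, .., X_i (x) X_(i+1), .., X_(n+1)) for i <= n; an index i > n is
   treated as n. *)
Fixpoint merge i n : pow C n.+2 -> pow C n.+1 :=
  match i with
  | 0 => fun s => (s.1 \ox s.2.1, s.2.2)
  | j.+1 =>
      match n return pow C n.+2 -> pow C n.+1 with
      | 0 => fun s => (s.1 \ox s.2.1, tt)
      | m.+1 => fun s => (s.1, @merge j m s.2)
      end
  end.

(* (X_0, .., X_(n-1)) and X_n *)
Fixpoint pinit n : pow C n.+1 -> pow C n :=
  match n with
  | 0 => fun _ => tt
  | m.+1 => fun s => (s.1, @pinit m s.2)
  end.

Fixpoint plast n : pow C n.+1 -> C :=
  match n with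
  | 0 => fun s => s.1
  | m.+1 => fun s => @plast m s.2
  end.

(* The composites of associators occurring in the coface maps; their source
    and target determine them, by coherence. *)

Definition assocL n (X Y Z : C) (t : pow C n) :
    hom (@tenL n ((X \ox Y) \ox Z, t)) (@tenL n (X \ox (Y \ox Z), t)) :=
  @tenLm n ((X \ox Y) \ox Z, t) (X \ox (Y \ox Z), t) (assoc X Y Z, pid t).

Fixpoint headL n : forall s : pow C n.+2, hom (tenL s) (s.1 \ox tenL (s.2 : pow C n.+1)) :=
  match n with
  | 0 => fun s => idm (s.1 \ox s.2.1)
  | m.+1 => fun s =>
      @headL m (s.1, (s.2.1 \ox s.2.2.1, s.2.2.2))
        \c assocL s.1 s.2.1 s.2.2.1 s.2.2.2
  end.

Fixpoint lastL n : forall s : pow C n.+2,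
    hom (tenL s) (tenL (pinit s) \ox plast s) :=
  match n with
  | 0 => fun s => idm (s.1 \ox s.2.1)
  | m.+1 => fun s => @lastL m (s.1 \ox s.2.1, s.2.2)
  end.

Fixpoint lastR n : forall s : pow C n.+2,
    hom (tenR (pinit s) \ox plast s) (tenR s) :=
  match n return forall s : pow C n.+2,
    hom (tenR (pinit s) \ox plast s) (tenR s) with
  | 0 => fun s => idm (s.1 \ox s.2.1)
  | m.+1 => fun s =>
      (idm s.1 \om @lastR m s.2)
        \c assoc s.1 (@tenR m (@pinit m.+1 s.2)) (@plast m.+1 s.2)
  end.

Fixpoint mergeL i : forall n (s : pow C n.+2), hom (tenL s) (tenL (merge i s)) :=
  match i return forall n (s : pow C n.+2), hom (tenL s) (tenL (merge i s)) with
  | 0 => fun n s => idm (tenL s)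
  | j.+1 => fun n =>
      match n return forall s : pow C n.+2,
        hom (tenL s) (tenL (merge j.+1 s)) with
      | 0 => fun s => idm (s.1 \ox s.2.1)
      | m.+1 =>
          match j return
            (forall n (s : pow C n.+2), hom (tenL s) (tenL (merge j s))) ->
            forall s : pow C m.+3, hom (tenL s) (tenL (merge j.+1 s)) with
          | 0 => fun _ s => assocL s.1 s.2.1 s.2.2.1 s.2.2.2
          | j'.+1 =>
              match m return
                (forall n (s : pow C n.+2),
                   hom (tenL s) (tenL (merge j'.+1 s))) ->
                forall s : pow C m.+3,
                  hom (tenL s) (tenL (merge j'.+2 s)) with
              | 0 => fun _ s => @assocL 0 s.1 s.2.1 s.2.2.1 tt
              | m'.+1 => fun rec s => rec m'.+1 (s.1 \ox s.2.1, s.2.2)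
              end
          end (@mergeL j)
      end
  end.

Fixpoint mergeR i n : forall s : pow C n.+2, hom (tenR (merge i s)) (tenR s) :=
  match i with
  | 0 =>
      match n return forall s : pow C n.+2, hom (tenR (merge 0 s)) (tenR s) with
      | 0 => fun s => idm (s.1 \ox s.2.1)
      | m.+1 => fun s => assoc s.1 s.2.1 (@tenR m s.2.2)
      end
  | j.+1 =>
      match n return forall s : pow C n.+2, hom (tenR (merge j.+1 s)) (tenR s) with
      | 0 => fun s => idm (s.1 \ox s.2.1)
      | m.+1 => fun s => idm s.1 \om @mergeR j m s.2
      end
  end.

End Tensors.

Section Naturality.
Variable C : semigroupal.

Fixpoint mergem i n : forall s t : pow C n.+2, phom s t ->
    phom (merge i s) (merge i t) :=
  match i return forall s t : pow C n.+2, phom s t ->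
    phom (merge i s) (merge i t) with
  | 0 => fun s t f => (f.1 \om f.2.1, f.2.2)
  | j.+1 =>
      match n return forall s t : pow C n.+2, phom s t ->
        phom (merge j.+1 s) (merge j.+1 t) with
      | 0 => fun s t f => (f.1 \om f.2.1, tt)
      | m.+1 => fun s t f => (f.1, @mergem j m s.2 t.2 f.2)
      end
  end.

Fixpoint pinitm n : forall s t : pow C n.+1, phom s t ->
    phom (pinit s) (pinit t) :=
  match n return forall s t : pow C n.+1, phom s t ->
    phom (pinit s) (pinit t) with
  | 0 => fun _ _ _ => tt
  | m.+1 => fun s t f => (f.1, @pinitm m s.2 t.2 f.2)
  end.

Fixpoint plastm n : forall s t : pow C n.+1, phom s t ->
    hom (plast s) (plast t) :=
  match n return forall s t : pow C n.+1, phom s t ->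
    hom (plast s) (plast t) with
  | 0 => fun _ _ f => f.1
  | m.+1 => fun s t f => @plastm m s.2 t.2 f.2
  end.

Fixpoint pcomp n : forall s t u : pow C n, phom t u -> phom s t -> phom s u :=
  match n with
  | 0 => fun _ _ _ _ _ => tt
  | m.+1 => fun s t u g f => (g.1 \c f.1, @pcomp m s.2 t.2 u.2 g.2 f.2)
  end.

Lemma tenLm1 n (s : pow C n.+1) : tenLm (pid s) = idm (tenL s).
Proof.
elim: n s => [//|n IH] s; rewrite -[RHS](IH (s.1 \ox s.2.1, s.2.2)) /=.
by rewrite tenm1.
Qed.

Lemma tenLmM n (s t u : pow C n.+1) (g : phom t u) (f : phom s t) :
  tenLm (pcomp g f) = tenLm g \c tenLm f.
Proof.
elim: n s t u g f => [//|n IH] s t u g f.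
rewrite /= -(IH (s.1 \ox s.2.1, s.2.2) (t.1 \ox t.2.1, t.2.2)
  (u.1 \ox u.2.1, u.2.2)) /=.
by rewrite tenmM.
Qed.

Lemma tenRm1 n (s : pow C n.+1) : tenRm (pid s) = idm (tenR s).
Proof. by elim: n s => [//|n IH] s; rewrite /= (IH s.2) tenm1. Qed.

Lemma tenRmM n (s t u : pow C n.+1) (g : phom t u) (f : phom s t) :
  tenRm (pcomp g f) = tenRm g \c tenRm f.
Proof.
by elim: n s t u g f => [//|n IH] s t u g f; rewrite /= (IH s.2 t.2) tenmM.
Qed.

Lemma pcomp1m n (s t : pow C n) (f : phom s t) : pcomp (pid t) f = f.
Proof.
elim: n s t f => [|n IH] s t; first by case.
by case=> f g; rewrite /= comp1m (IH s.2 t.2).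
Qed.

Lemma pcompm1 n (s t : pow C n) (f : phom s t) : pcomp f (pid s) = f.
Proof.
elim: n s t f => [|n IH] s t; first by case.
by case=> f g; rewrite /= compm1 (IH s.2 t.2).
Qed.

Lemma assocL_nat n X X' Y Y' Z Z' (t t' : pow C n) (f : hom X X')
    (g : hom Y Y') (h : hom Z Z') (u : phom t t') :
  assocL X' Y' Z' t' \c
    @tenLm C n ((X \ox Y) \ox Z, t) ((X' \ox Y') \ox Z', t') ((f \om g) \om h, u) =
  @tenLm C n (X \ox (Y \ox Z), t) (X' \ox (Y' \ox Z'), t') (f \om (g \om h), u)
    \c assocL X Y Z t.
Proof.
rewrite /assocL -!tenLmM; congr tenLm => /=.
by rewrite assoc_nat pcomp1m pcompm1.
Qed.

Lemma headL_nat n (s t : pow C n.+2) (f : phom s t) :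
  headL t \c tenLm f = (f.1 \om @tenLm C n s.2 t.2 f.2) \c headL s.
Proof.
elim: n s t f => [|n IH] s t f; first by rewrite /= comp1m compm1.
rewrite /= -compA assocL_nat !compA; congr (_ \c _).
exact: (IH (s.1, (s.2.1 \ox s.2.2.1, s.2.2.2)) (t.1, (t.2.1 \ox t.2.2.1, t.2.2.2))
  (f.1, (f.2.1 \om f.2.2.1, f.2.2.2))).
Qed.

Lemma lastL_nat n (s t : pow C n.+2) (f : phom s t) :
  lastL t \c tenLm f = (tenLm (pinitm f) \om plastm f) \c lastL s.
Proof.
elim: n s t f => [|n IH] s t f; first by rewrite /= comp1m compm1.
exact: (IH (s.1 \ox s.2.1, s.2.2) (t.1 \ox t.2.1, t.2.2)
  (f.1 \om f.2.1, f.2.2)).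
Qed.

Lemma lastR_nat n (s t : pow C n.+2) (f : phom s t) :
  lastR t \c (tenRm (pinitm f) \om plastm f) = tenRm f \c lastR s.
Proof.
elim: n s t f => [|n IH] s t f; first by rewrite /= comp1m compm1.
have := IH s.2 t.2 f.2; rewrite /= => E.
by rewrite -compA assoc_nat !compA -!tenmM comp1m compm1 E.
Qed.

Lemma mergeL_nat i n (s t : pow C n.+2) (f : phom s t) :
  mergeL i t \c tenLm f = tenLm (mergem i f) \c mergeL i s.
Proof.
elim: i n s t f => [|i IH] n s t f; first by rewrite /= comp1m compm1.
case: n s t f => [|n] s t f; first by rewrite /= comp1m compm1.
case: i IH => [|i] IH; first exact: assocL_nat.
case: n s t f => [|n] s t f.
  exact: (@assocL_nat 0 _ _ _ _ _ _ tt tt _ _ _ tt).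
exact: (IH n.+1 (s.1 \ox s.2.1, s.2.2) (t.1 \ox t.2.1, t.2.2)
  (f.1 \om f.2.1, f.2.2)).
Qed.

Lemma mergeR_nat i n (s t : pow C n.+2) (f : phom s t) :
  mergeR i t \c tenRm (mergem i f) = tenRm f \c mergeR i s.
Proof.
elim: i n s t f => [|i IH] [|n] s t f; try by rewrite /= comp1m compm1.
  exact: assoc_nat.
by rewrite /= -!tenmM comp1m compm1 IH.
Qed.

End Naturality.

Section DYCochains.
Variables (k : fieldType) (C : ksemigroupal k).

Lemma comp_is_linearl (X Y Z : C) (f : hom X Y) :
  linear (fun g : hom Y Z => g \c f).
Proof. exact: (@comp_linearl _ _ (klin C)). Qed.

Lemma comp_is_linearr (X Y Z : C) (g : hom Y Z) :
  linear (fun f : hom X Y => g \c f).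
Proof. exact: (@comp_linearr _ _ (klin C)). Qed.

Lemma tenm_is_linearl (X Y A : C) :
  linear (fun f : hom X Y => f \om idm A).
Proof. exact: ten_linearl. Qed.

Lemma tenm_is_linearr (X Y A : C) :
  linear (fun f : hom X Y => idm A \om f).
Proof. exact: ten_linearr. Qed.

Lemma comp0m (X Y Z : C) (f : hom X Y) : (0 : hom Y Z) \c f = 0.
Proof.
have := comp_is_linearl f (-1) (0 : hom Y Z) 0.
by rewrite !scaleN1r oppr0 add0r addNr.
Qed.

Lemma compm0 (X Y Z : C) (g : hom Y Z) : g \c (0 : hom X Y) = 0.
Proof.
have := comp_is_linearr g (-1) (0 : hom X Y) 0.
by rewrite !scaleN1r oppr0 add0r addNr.
Qed.

Definition DYfam (n : nat) := forall s : pow C n.+1, hom (tenL s) (tenR s).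

Section Lmodule.
Variable n : nat.
HB.instance Definition _ := gen_eqMixin (DYfam n).
HB.instance Definition _ := gen_choiceMixin (DYfam n).

Definition fam0 : DYfam n := fun=> 0.
Definition fam_opp (a : DYfam n) : DYfam n := fun s => - a s.
Definition fam_add (a b : DYfam n) : DYfam n := fun s => a s + b s.
Definition fam_scale (x : k) (a : DYfam n) : DYfam n := fun s => x *: a s.

Lemma fam_addA : associative fam_add.
Proof. by move=> a b c; apply: functional_extensionality_dep => s; exact: addrA. Qed.
Lemma fam_addC : commutative fam_add.
Proof. by move=> a b; apply: functional_extensionality_dep => s; exact: addrC. Qed.
Lemma fam_add0 : left_id fam0 fam_add.
Proof. by move=> a; apply: functional_extensionality_dep => s; exact: add0r. Qed.
Lemma fam_addN : left_inverse fam0 fam_opp fam_add.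
Proof. by move=> a; apply: functional_extensionality_dep => s; exact: addNr. Qed.
HB.instance Definition _ :=
  GRing.isZmodule.Build (DYfam n) fam_addA fam_addC fam_add0 fam_addN.

Lemma fam_scaleA x y (a : DYfam n) :
  fam_scale x (fam_scale y a) = fam_scale (x * y) a.
Proof. by apply: functional_extensionality_dep => s; exact: scalerA. Qed.
Lemma fam_scale1 : left_id 1 fam_scale.
Proof. by move=> a; apply: functional_extensionality_dep => s; exact: scale1r. Qed.
Lemma fam_scaleDr : right_distributive fam_scale +%R.
Proof. by move=> x a b; apply: functional_extensionality_dep => s; exact: scalerDr. Qed.
Lemma fam_scaleDl (a : DYfam n) : {morph fam_scale^~ a : x y / x + y}.
Proof. by move=> x y; apply: functional_extensionality_dep => s; exact: scalerDl. Qed.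
HB.instance Definition _ := GRing.Zmodule_isLmodule.Build k (DYfam n)
  fam_scaleA fam_scale1 fam_scaleDr fam_scaleDl.
End Lmodule.

Lemma famP n (x : k) (a b : DYfam n) s : (x *: a + b) s = x *: a s + b s.
Proof. by []. Qed.

(* Degree n + 1: natural transformations from the left-bracketed to the
   right-bracketed tensor product of n + 1 objects. *)
Definition DYnatural n (a : DYfam n) : Prop :=
  forall (s t : pow C n.+1) (f : phom s t), a t \c tenLm f = tenRm f \c a s.

Definition DYnatb n : {pred DYfam n} := fun a => `[< DYnatural a >].

Lemma DYnatb_submod n : submod_closed (@DYnatb n).
Proof.
have nat_lin x a b : DYnatural a -> DYnatural b -> @DYnatural n (x *: a + b).
  move=> na nb s t f; rewrite !famP.
  by rewrite comp_is_linearl comp_is_linearr na nb.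
split=> [|x a b /asboolP na /asboolP nb]; apply/asboolP; last exact: nat_lin.
move=> s t f; rewrite (_ : (0 : DYfam n) t = 0) // (_ : (0 : DYfam n) s = 0) //.
by rewrite comp0m compm0.
Qed.

HB.instance Definition _ n :=
  GRing.isSubmodClosed.Build k (DYfam n) (@DYnatb n) (DYnatb_submod n).

Record DYnat n := MkDYnat { dyfam :> DYfam n; _ : dyfam \in @DYnatb n }.
HB.instance Definition _ n := [isSub for @dyfam n].
HB.instance Definition _ n := [Choice of DYnat n by <:].
HB.instance Definition _ n := [SubChoice_isSubLmodule of DYnat n by <:].

Lemma dynatP n (a : DYnat n) : DYnatural a.
Proof. by case: a => a /= /asboolP. Qed.

Lemma dynat_linear n (x : k) (a b : DYnat n) s :
  dyfam (x *: a + b) s = x *: dyfam a s + dyfam b s.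
Proof. by []. Qed.

Lemma dynat_inj n (a b : DYnat n) : (forall s, dyfam a s = dyfam b s) -> a = b.
Proof. by move=> E; apply/val_inj/functional_extensionality_dep. Qed.

(* The i-th coface map, for 0 <= i <= n + 2, in degree n + 1. *)
Definition coface_fam n (i : nat) (a : DYfam n) : DYfam n.+1 :=
  match i with
  | 0 => fun s => (idm s.1 \om a s.2) \c headL s
  | j.+1 => if (j <= n)%N
            then fun s => mergeR j s \c a (merge j s) \c mergeL j s
            else fun s => lastR s \c (a (pinit s) \om idm (plast s)) \c lastL s
  end.

Lemma coface_natural n i (a : DYnat n) : coface_fam i a \in @DYnatb n.+1.
Proof.
apply/asboolP => s t f; case: i => [|i] /=.
  rewrite -[LHS]compA headL_nat !compA -!tenmM comp1m compm1.
  by rewrite (dynatP a (f.2 : @phom C n.+1 s.2 t.2)).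
case: leqP => _.
  rewrite -[LHS]compA mergeL_nat !compA -(compA (mergeR i t)) (dynatP a).
  by rewrite compA mergeR_nat.
rewrite -[LHS]compA lastL_nat !compA -(compA (lastR t)) -tenmM (dynatP a).
rewrite comp1m -[X in _ \om X]compm1 tenmM compA.
by rewrite -[in RHS]lastR_nat.
Qed.

Definition coface n (i : nat) (a : DYnat n) : DYnat n.+1 :=
  MkDYnat (coface_natural i a).

Lemma coface_firstE n (a : DYnat n) s :
  dyfam (coface 0 a) s = (idm s.1 \om dyfam a s.2) \c headL s.
Proof. by []. Qed.

Lemma coface_midE n i (a : DYnat n) s : (i <= n)%N ->
  dyfam (coface i.+1 a) s = mergeR i s \c dyfam a (merge i s) \c mergeL i s.
Proof. by move=> le_in; rewrite /= le_in. Qed.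

Lemma coface_lastE n i (a : DYnat n) s : (n < i)%N ->
  dyfam (coface i.+1 a) s =
  lastR s \c (dyfam a (pinit s) \om idm (plast s)) \c lastL s.
Proof. by rewrite ltnNge /= => /negPf ->. Qed.

Lemma coface_linear n i : linear (@coface n i).
Proof.
move=> x a b; apply: dynat_inj => s; rewrite dynat_linear /=.
case: i => [|i] /=; first by rewrite tenm_is_linearr comp_is_linearl.
case: leqP => _; first by rewrite comp_is_linearr comp_is_linearl.
by rewrite tenm_is_linearl comp_is_linearr comp_is_linearl.
Qed.

HB.instance Definition _ n i :=
  GRing.isLinear.Build k (DYnat n) (DYnat n.+1) *:%R (@coface n i)
    (coface_linear i).

Definition DYdiff n (a : DYnat n) : DYnat n.+1 :=
  \sum_(i < n.+3) (-1) ^+ i *: coface i a.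

Lemma DYdiff_linear n : linear (@DYdiff n).
Proof.
move=> x a b; rewrite /DYdiff scaler_sumr -big_split /=.
by apply: eq_bigr => i _; rewrite linearP scalerDr !scalerA mulrC.
Qed.

HB.instance Definition _ n :=
  GRing.isLinear.Build k (DYnat n) (DYnat n.+1) *:%R (@DYdiff n)
    (@DYdiff_linear n).

(* The complex is concentrated in degrees >= 1: it is 0 in degree 0. *)
Definition DYC (n : nat) : lmodType k :=
  if n is m.+1 then DYnat m else 'rV[k]_0.

Definition DYd (n : nat) : {linear DYC n -> DYC n.+1} :=
  match n return {linear DYC n -> DYC n.+1} with
  | 0 => \0
  | m.+1 => @DYdiff m
  end.

End DYCochains.

Section LmodQuotient.
Variables (R : pzRingType) (V : lmodType R) (I : zmodClosed V).
Hypothesis scaleI : GRing.scaler_closed I.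
Local Open Scope quotient_scope.

Definition lmod_quot & GRing.scaler_closed I := Quotient.quot I.
Local Notation Q := (lmod_quot scaleI).
HB.instance Definition _ := GRing.Zmodule.on Q.

Definition lmod_pi (v : V) : Q := \pi_(Quotient.quot I) v.

Lemma lmod_piP u v : lmod_pi u = lmod_pi v <-> u - v \in I.
Proof. by rewrite Quotient.idealrBE; split=> /eqP. Qed.

Lemma lmod_piW (P : Q -> Prop) : (forall v, P (lmod_pi v)) -> forall x, P x.
Proof. by move=> PV x; rewrite -[x]reprK; exact: PV. Qed.

Definition quot_scale (a : R) (x : Q) : Q :=
  lmod_pi (a *: repr (x : Quotient.quot I)).

Lemma quot_scale_pi a v : quot_scale a (lmod_pi v) = lmod_pi (a *: v).
Proof.
apply/lmod_piP; rewrite -scalerBr; apply: scaleI.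
by apply/lmod_piP; rewrite /lmod_pi reprK.
Qed.

Lemma lmod_piD u v : lmod_pi (u + v) = lmod_pi u + lmod_pi v.
Proof. exact: (raddfD (\pi_(Quotient.quot I))). Qed.

Lemma quot_scaleA a b x : quot_scale a (quot_scale b x) = quot_scale (a * b) x.
Proof. by elim/lmod_piW: x => v; rewrite !quot_scale_pi scalerA. Qed.

Lemma quot_scale1 : left_id 1 quot_scale.
Proof. by elim/lmod_piW=> v; rewrite quot_scale_pi scale1r. Qed.

Lemma quot_scaleDr : right_distributive quot_scale +%R.
Proof.
move=> a; elim/lmod_piW=> u; elim/lmod_piW=> v.
by rewrite -lmod_piD !quot_scale_pi scalerDr lmod_piD.
Qed.

Lemma quot_scaleDl x : {morph quot_scale^~ x : a b / a + b}.
Proof.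
by elim/lmod_piW: x => v a b; rewrite !quot_scale_pi scalerDl lmod_piD.
Qed.

HB.instance Definition _ := GRing.Zmodule_isLmodule.Build R Q
  quot_scaleA quot_scale1 quot_scaleDr quot_scaleDl.

Lemma lmod_pi_linear : linear lmod_pi.
Proof. by move=> a u v; rewrite lmod_piD -quot_scale_pi. Qed.
HB.instance Definition _ := GRing.isLinear.Build R V Q *:%R lmod_pi
  lmod_pi_linear.

End LmodQuotient.

(* The quotient of the n-cocycles by those coboundaries that are cocycles; when
   d \o d = 0 these are all the coboundaries. *)
Section Cohomology.
Variables (k : fieldType) (K : nat -> lmodType k).
Variable d : forall n, {linear K n -> K n.+1}.

Definition cocycleb n : {pred K n} := fun x => d n x == 0.

Lemma cocycleb_submod n : submod_closed (@cocycleb n).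
Proof.
split=> [|a u v /eqP du /eqP dv]; apply/eqP; first by rewrite linear0.
by rewrite linearP du dv scaler0 addr0.
Qed.
HB.instance Definition _ n :=
  GRing.isSubmodClosed.Build k (K n) (@cocycleb n) (cocycleb_submod n).

Record cocycle n := MkCocycle { cocval : K n; _ : cocval \in @cocycleb n }.
HB.instance Definition _ n := [isSub for @cocval n].
HB.instance Definition _ n := [Choice of cocycle n by <:].
HB.instance Definition _ n := [SubChoice_isSubLmodule of cocycle n by <:].

Definition is_coboundary n : K n -> Prop :=
  match n with
  | 0 => fun x => x = 0
  | m.+1 => fun x => exists y : K m, x = d m y
  end.

Definition coboundaryb n : {pred cocycle n} :=
  fun z => `[< is_coboundary (cocval z) >].

Lemma coboundaryb_submod n : submod_closed (@coboundaryb n).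
Proof.
case: n => [|n]; split=> [|a u v /asboolP /= Bu /asboolP /= Bv].
- exact/asboolP.
- by apply/asboolP; rewrite /= Bu Bv scaler0 addr0.
- by apply/asboolP; exists 0; rewrite linear0.
case: Bu Bv => [x ux] [y vy]; apply/asboolP; exists (a *: x + y).
by rewrite linearP /= ux vy.
Qed.
HB.instance Definition _ n :=
  GRing.isSubmodClosed.Build k (cocycle n) (@coboundaryb n)
    (coboundaryb_submod n).

Lemma coboundaryb_scaler n : GRing.scaler_closed (@coboundaryb n).
Proof. exact: GRing.subsemimod_closedZ (GRing.submod_closed_semi (coboundaryb_submod n)). Qed.

Definition cohomology n : lmodType k := lmod_quot (@coboundaryb_scaler n).

Definition coclass n (z : cocycle n) : cohomology n :=
  lmod_pi (@coboundaryb_scaler n) z.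

End Cohomology.

Section CohomologyMap.
Variables (k : fieldType) (K L : nat -> lmodType k).
Variables (d : forall n, {linear K n -> K n.+1}).
Variables (d' : forall n, {linear L n -> L n.+1}).
Variable (f : forall n, {linear K n -> L n}).
Hypothesis fd : forall n x, f n.+1 (d n x) = d' n (f n x).

Lemma cocycle_map_subproof n (z : cocycle d n) : f n (cocval z) \in @cocycleb _ _ d' n.
Proof. by case: z => x /= /eqP dx; apply/eqP; rewrite -fd dx linear0. Qed.

Definition cocycle_map n (z : cocycle d n) : cocycle d' n :=
  MkCocycle (cocycle_map_subproof z).

Definition cohomology_map n (x : cohomology d n) : cohomology d' n :=
  coclass (cocycle_map (repr (x : Quotient.quot (@coboundaryb _ _ d n)))).

Lemma cohomology_mapE n (z : cocycle d n) :
  cohomology_map (coclass z) = coclass (cocycle_map z).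
Proof.
apply/lmod_piP; set w := repr _.
have /asboolP B : w - z \in @coboundaryb _ _ d n.
  by rewrite Quotient.idealrBE reprK.
apply/asboolP; move: w B => w; rewrite /= -linearB /=.
case: n z w => [|n] z w /= B; first by rewrite B linear0.
by case: B => y ->; exists (f n y); rewrite fd.
Qed.

Lemma cohomology_map_linear n : linear (@cohomology_map n).
Proof.
move=> a; elim/lmod_piW=> u; elim/lmod_piW=> v.
rewrite -linearP !cohomology_mapE -[RHS]linearP.
by congr coclass; apply: val_inj; rewrite /= linearP.
Qed.

HB.instance Definition _ n := GRing.isLinear.Build k (cohomology d n)
  (cohomology d' n) *:%R (@cohomology_map n) (@cohomology_map_linear n).

End CohomologyMap.

Section Transport.
Variables (C D : semigroupal) (F : sgfunctor C D).

Fixpoint pmap n : pow C n -> pow D n :=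
  match n with
  | 0 => fun _ => tt
  | m.+1 => fun s => (F s.1, @pmap m s.2)
  end.

Fixpoint pmapm n : forall s t : pow C n, phom s t -> phom (pmap s) (pmap t) :=
  match n return forall s t : pow C n, phom s t -> phom (pmap s) (pmap t) with
  | 0 => fun _ _ _ => tt
  | m.+1 => fun s t f => (fmap F f.1, @pmapm m s.2 t.2 f.2)
  end.

Definition sgmL n (X Y : C) (t : pow C n) :
    hom (@tenL D n (F X \ox F Y, pmap t)) (@tenL D n (F (X \ox Y), pmap t)) :=
  @tenLm D n (F X \ox F Y, pmap t) (F (X \ox Y), pmap t) (sgm F X Y, pid _).

Definition sgmLi n (X Y : C) (t : pow C n) :
    hom (@tenL D n (F (X \ox Y), pmap t)) (@tenL D n (F X \ox F Y, pmap t)) :=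
  @tenLm D n (F (X \ox Y), pmap t) (F X \ox F Y, pmap t) (sgmi F X Y, pid _).

(* The canonical isomorphisms between the tensor product of the F X_i and the
   value of F at the tensor product of the X_i, for both bracketings. *)
Fixpoint sgL n : forall s : pow C n.+1, hom (@tenL D n (pmap s)) (F (tenL s)) :=
  match n return forall s : pow C n.+1, hom (@tenL D n (pmap s)) (F (tenL s)) with
  | 0 => fun s => idm (F s.1)
  | m.+1 => fun s => @sgL m (s.1 \ox s.2.1, s.2.2) \c sgmL s.1 s.2.1 s.2.2
  end.

Fixpoint sgLi n : forall s : pow C n.+1, hom (F (tenL s)) (@tenL D n (pmap s)) :=
  match n return forall s : pow C n.+1, hom (F (tenL s)) (@tenL D n (pmap s)) with
  | 0 => fun s => idm (F s.1)
  | m.+1 => fun s => sgmLi s.1 s.2.1 s.2.2 \c @sgLi m (s.1 \ox s.2.1, s.2.2)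
  end.

Fixpoint sgR n : forall s : pow C n.+1, hom (@tenR D n (pmap s)) (F (tenR s)) :=
  match n return forall s : pow C n.+1, hom (@tenR D n (pmap s)) (F (tenR s)) with
  | 0 => fun s => idm (F s.1)
  | m.+1 => fun s =>
      sgm F s.1 (@tenR C m s.2) \c (idm (F s.1) \om @sgR m s.2)
  end.

Lemma sgmLK n X Y (t : pow C n) : sgmLi X Y t \c sgmL X Y t = idm _.
Proof. by rewrite /sgmL /sgmLi -tenLmM /= sgmK pcomp1m (tenLm1 (_, _)). Qed.

Lemma sgmLiK n X Y (t : pow C n) : sgmL X Y t \c sgmLi X Y t = idm _.
Proof. by rewrite /sgmL /sgmLi -tenLmM /= sgmiK pcomp1m (tenLm1 (_, _)). Qed.

Lemma sgLK n (s : pow C n.+1) : sgLi s \c sgL s = idm _.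
Proof.
elim: n s => [|n IH] s /=; first by rewrite comp1m.
by rewrite -compA (compA (sgLi _)) (IH (s.1 \ox s.2.1, s.2.2)) comp1m sgmLK.
Qed.

Lemma sgLiK n (s : pow C n.+1) : sgL s \c sgLi s = idm _.
Proof.
elim: n s => [|n IH] s /=; first by rewrite comp1m.
rewrite -compA (compA (sgmL _ _ _)) sgmLiK comp1m.
exact: (IH (s.1 \ox s.2.1, s.2.2)).
Qed.

Lemma sgL_nat n (s t : pow C n.+1) (f : phom s t) :
  sgL t \c @tenLm D n _ _ (pmapm f) = fmap F (tenLm f) \c sgL s.
Proof.
elim: n s t f => [|n IH] s t f; first by rewrite /= comp1m compm1.
rewrite /= [RHS]compA -(IH (s.1 \ox s.2.1, s.2.2) (t.1 \ox t.2.1, t.2.2)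
  (f.1 \om f.2.1, f.2.2)) /= -!compA; congr (_ \c _).
rewrite /sgmL -!(@tenLmM D n (_, _) (_, _) (_, _)) /=.
by rewrite sgm_nat pcomp1m pcompm1.
Qed.

Lemma sgR_nat n (s t : pow C n.+1) (f : phom s t) :
  sgR t \c @tenRm D n _ _ (pmapm f) = fmap F (tenRm f) \c sgR s.
Proof.
elim: n s t f => [|n IH] s t f; first by rewrite /= comp1m compm1.
rewrite /= -compA -tenmM comp1m (IH s.2 t.2) compA -sgm_nat -compA -tenmM.
by rewrite compm1.
Qed.

Lemma pmapm1 n (s : pow C n) : pmapm (pid s) = pid (pmap s).
Proof. by elim: n s => [//|n IH] s; rewrite /= fmap1 IH. Qed.

Lemma sgL_assoc n X Y Z (t : pow C n) :
  fmap F (assocL X Y Z t) \c @sgL n.+2 (X, (Y, (Z, t))) =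
  @sgL n.+1 (X, (Y \ox Z, t))
    \c @tenLm D n (F X \ox (F Y \ox F Z), pmap t) (F X \ox F (Y \ox Z), pmap t)
         (idm (F X) \om sgm F Y Z, pid _)
    \c assocL (F X) (F Y) (F Z) (pmap t).
Proof.
have E := @sgL_nat n ((X \ox Y) \ox Z, t) (X \ox (Y \ox Z), t)
  (assoc X Y Z, pid t).
rewrite /= !compA -[fmap F _]/(fmap F (tenLm _)) -E -!compA; congr (_ \c _).
move=> {E} /=.
rewrite /sgmL /assocL -!(@tenLmM D n (_, _) (_, _) (_, _)) /=.
by rewrite pmapm1 !pcomp1m compA hexagon -compA.
Qed.

Lemma sgL_head n (s : pow C n.+2) :
  fmap F (headL s) \c sgL s =
  sgm F s.1 (@tenL C n s.2) \c (idm (F s.1) \om @sgL n s.2)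
    \c @headL D n (pmap s).
Proof.
elim: n s => [|n IH] s.
  by rewrite /= /sgmL /= fmap1 !comp1m tenm1 !compm1.
rewrite [headL s]/= fmapM -compA.
rewrite (@sgL_assoc n s.1 s.2.1 s.2.2.1 s.2.2.2).
set A := assocL _ _ _ (pmap _); set T := tenLm _.
have E := IH (s.1, (s.2.1 \ox s.2.2.1, s.2.2.2)).
transitivity (fmap F (@headL C n (s.1, (s.2.1 \ox s.2.2.1, s.2.2.2)))
  \c @sgL n.+1 (s.1, (s.2.1 \ox s.2.2.1, s.2.2.2)) \c T \c A).
  by rewrite -!compA.
rewrite {}E /= -!compA; congr (_ \c _).
rewrite -[in RHS](comp1m (idm (F s.1))) tenmM -compA; congr (_ \c _).
have H := @headL_nat D n (F s.1, (F s.2.1 \ox F s.2.2.1, pmap s.2.2.2))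
  (F s.1, (F (s.2.1 \ox s.2.2.1), pmap s.2.2.2))
  (idm _, (sgm F _ _, pid _)).
apply: etrans (compA _ _ _) _.
apply: etrans (congr1 (comp^~ A) H) _.
exact: esym (compA _ _ _).
Qed.

Lemma pinitm1 n (s : pow D n.+1) : pinitm (pid s) = pid (pinit s).
Proof. by elim: n s => [//|n IH] s; rewrite /= -(IH s.2). Qed.

Lemma plastm1 n (s : pow D n.+1) : plastm (pid s) = idm (plast s).
Proof. by elim: n s => [//|n IH] s; rewrite /= -(IH s.2). Qed.

Fixpoint pinit_pmap n : forall s : pow C n.+1,
    phom (@pinit D n (pmap s)) (pmap (pinit s)) :=
  match n return forall s : pow C n.+1,
    phom (@pinit D n (pmap s)) (pmap (pinit s)) with
  | 0 => fun _ => tt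
  | m.+1 => fun s => (idm (F s.1), @pinit_pmap m s.2)
  end.

Fixpoint plast_pmap n : forall s : pow C n.+1,
    hom (@plast D n (pmap s)) (F (plast s)) :=
  match n return forall s : pow C n.+1,
    hom (@plast D n (pmap s)) (F (plast s)) with
  | 0 => fun s => idm (F s.1)
  | m.+1 => fun s => @plast_pmap m s.2
  end.

Fixpoint merge_pmap i n : forall s : pow C n.+2,
    phom (@merge D i n (pmap s)) (pmap (merge i s)) :=
  match i return forall s : pow C n.+2,
    phom (@merge D i n (pmap s)) (pmap (merge i s)) with
  | 0 => fun s => (sgm F s.1 s.2.1, pid (pmap s.2.2))
  | j.+1 =>
      match n return forall s : pow C n.+2,
        phom (@merge D j.+1 n (pmap s)) (pmap (merge j.+1 s)) with
      | 0 => fun s => (sgm F s.1 s.2.1, tt)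
      | m.+1 => fun s => (idm (F s.1), @merge_pmap j m s.2)
      end
  end.

Lemma sgL_last n (s : pow C n.+2) :
  fmap F (lastL s) \c sgL s =
  sgm F (tenL (pinit s)) (plast s) \c (@sgL n (pinit s) \om idm _)
    \c (@tenLm D n _ _ (pinit_pmap s) \om @plast_pmap n.+1 s)
    \c @lastL D n (pmap s).
Proof.
elim: n s => [|n IH] s.
  by rewrite /= /sgmL /= fmap1 !comp1m tenm1 !compm1.
have E := IH (s.1 \ox s.2.1, s.2.2).
have H := @lastL_nat D n (F s.1 \ox F s.2.1, pmap (s.2.2 : pow C n.+1))
  (F (s.1 \ox s.2.1), pmap (s.2.2 : pow C n.+1))
  (sgm F s.1 s.2.1, @pid D n.+1 _).
apply: etrans (compA _ _ _) _; apply: etrans (congr1 (comp^~ _) E) _.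
apply: etrans (esym (compA _ _ _)) _; apply: etrans (congr1 (comp _) H) _.
apply: etrans (compA _ _ _) _; congr (_ \c _); rewrite -!compA; congr (_ \c _).
rewrite -!tenmM; congr (_ \om _); last first.
  congr (_ \c _).
  exact: etrans (congr1 (comp _) (@plastm1 n (pmap (s.2.2 : pow C n.+1)))) (compm1 _).
apply: etrans _ (compA _ _ _); congr (_ \c _).
apply: etrans (esym (tenLmM _ _)) _; apply: etrans _ (tenLmM _ _).
congr tenLm; rewrite /= tenm1 compm1 comp1m.
by rewrite (@pinitm1 n (pmap (s.2.2 : pow C n.+1))) pcomp1m pcompm1.
Qed.

Lemma hexagon_ten X A Z W (l : hom (A \ox Z) W) A' (a : hom A' (F A))
    Z' (z : hom Z' (F Z)) :
  fmap F ((idm X \om l) \c assoc X A Z) \c sgm F (X \ox A) Z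
    \c ((sgm F X A \c (idm (F X) \om a)) \om z) =
  sgm F X W \c (idm (F X) \om (fmap F l \c sgm F A Z \c (a \om z)))
    \c assoc (F X) A' Z'.
Proof.
rewrite fmapM -[z in LHS]comp1m tenmM !compA -(compA (fmap F (idm X \om l))).
rewrite -(compA (fmap F (idm X \om l))) hexagon !compA -sgm_nat fmap1.
rewrite -!(compA (sgm F X W)) -!compA assoc_nat; congr (_ \c _).
by rewrite !compA -!tenmM !comp1m.
Qed.

Lemma hexagon_ten' X A Z W (l : hom (A \ox Z) W) A' (a : hom A' (F A))
    A'' (t : hom A'' A') Z' (z : hom Z' (F Z)) :
  fmap F ((idm X \om l) \c assoc X A Z) \c sgm F (X \ox A) Z
    \c ((sgm F X A \c (idm (F X) \om a)) \om idm (F Z))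
    \c ((idm (F X) \om t) \om z) =
  sgm F X W
    \c (idm (F X) \om (fmap F l \c sgm F A Z \c (a \om idm (F Z)) \c (t \om z)))
    \c assoc (F X) A'' Z'.
Proof.
rewrite -compA -tenmM comp1m -(compA (sgm F X A)) -tenmM comp1m hexagon_ten.
by rewrite -(compA _ (a \om _)) -tenmM comp1m.
Qed.

Lemma sgR_last n (s : pow C n.+2) :
  fmap F (lastR s) \c sgm F (tenR (pinit s)) (plast s)
    \c (@sgR n (pinit s) \om idm _)
    \c (@tenRm D n _ _ (pinit_pmap s) \om @plast_pmap n.+1 s) =
  sgR s \c @lastR D n (pmap s).
Proof.
elim: n s => [|n IH] s.
  by rewrite /= fmap1 !comp1m tenm1 !compm1.
have E := IH s.2.
pose u : pow C n.+2 := s.2.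
have K := @hexagon_ten' s.1 _ _ _ (lastR u) _ (@sgR n (pinit u))
  _ (@tenRm D n _ _ (pinit_pmap u)) _ (plast_pmap u).
apply: etrans K _.
apply: etrans (congr1 (fun x => sgm F s.1 _ \c (idm _ \om x) \c assoc _ _ _) E) _.
by rewrite -{1}(comp1m (idm (F s.1))) tenmM /= !compA.
Qed.

Lemma mergem1 i n (s : pow D n.+2) : mergem i (pid s) = pid (merge i s).
Proof.
elim: i n s => [|i IH] [|n] s; rewrite /= ?tenm1 //.
by rewrite (IH n s.2).
Qed.

Lemma sgL_merge i n (s : pow C n.+2) :
  fmap F (mergeL i s) \c sgL s =
  sgL (merge i s) \c @tenLm D n _ _ (merge_pmap i s) \c @mergeL D i n (pmap s).
Proof.
elim: i n s => [|i IH] n s; first by rewrite /= fmap1 comp1m compm1.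
case: n s => [|n] s.
  by rewrite /= /sgmL /= fmap1 !comp1m !compm1.
case: i IH => [|i] IH; first exact: sgL_assoc.
case: n s => [|n] s; first exact: (@sgL_assoc 0 _ _ _ tt).
have E := IH n.+1 (s.1 \ox s.2.1, s.2.2).
have H := @mergeL_nat D i.+1 n.+1
  (F s.1 \ox F s.2.1, pmap (s.2.2 : pow C n.+2))
  (F (s.1 \ox s.2.1), pmap (s.2.2 : pow C n.+2))
  (sgm F s.1 s.2.1, @pid D n.+2 _).
apply: etrans (compA _ _ _) _; apply: etrans (congr1 (comp^~ _) E) _.
apply: etrans (esym (compA _ _ _)) _; apply: etrans (congr1 (comp _) H) _.
apply: etrans (compA _ _ _) _; congr (_ \c _).
apply: etrans (esym (compA _ _ _)) _.
apply: etrans _ (compA _ _ _); congr (_ \c _).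
apply: etrans (esym (tenLmM _ _)) _; apply: etrans _ (tenLmM _ _).
congr tenLm.
have P := @mergem1 i n (pmap (s.2.2 : pow C n.+2)).
by rewrite /= in P *; rewrite P tenm1 !comp1m !compm1 !pcomp1m !pcompm1.
Qed.

Lemma hexagon_assoc X Y Z A' (a : hom A' (F Z)) :
  fmap F (assoc X Y Z) \c (sgm F (X \ox Y) Z \c (idm _ \om a))
    \c (sgm F X Y \om idm A') =
  sgm F X (Y \ox Z) \c (idm (F X) \om (sgm F Y Z \c (idm (F Y) \om a)))
    \c assoc (F X) (F Y) A'.
Proof.
rewrite -!compA -tenmM comp1m compm1 -{1}(comp1m a) -{1}(compm1 (sgm F X Y)).
rewrite tenmM !compA hexagon -!compA; congr (_ \c _).
by rewrite -tenm1 assoc_nat !compA -!tenmM !comp1m.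
Qed.

Lemma sgR_merge i n (s : pow C n.+2) :
  fmap F (mergeR i s) \c sgR (merge i s) \c @tenRm D n _ _ (merge_pmap i s) =
  sgR s \c @mergeR D i n (pmap s).
Proof.
elim: i n s => [|i IH] [|n] s.
- by rewrite /= fmap1 !comp1m tenm1 !compm1.
- pose u : pow C n.+1 := s.2.2.
  have K := @hexagon_assoc s.1 s.2.1 _ _ (@sgR n u).
  apply: etrans _ K; congr (_ \c (_ \om _)).
  exact: (@tenRm1 D n (pmap u)).
- by rewrite /= fmap1 !comp1m tenm1 !compm1.
have E := IH n s.2.
rewrite /= -!compA -tenmM comp1m (compA (fmap F _)) -sgm_nat fmap1 -!compA.
by rewrite -!tenmM !comp1m -E compA.
Qed.

End Transport.

Section Restriction.
Variables (k : fieldType) (C D : ksemigroupal k) (F : sgfunctor C D).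
Hypotheses (linF : klinear_functor F) (ffF : fully_faithful F).

Lemma ff_inj (X Y : C) : injective (@fmap C D F X Y).
Proof. exact: bij_inj (ffF X Y). Qed.

Lemma ff_surj (X Y : C) (g : hom (F X) (F Y)) : exists f : hom X Y, fmap F f == g.
Proof. by have [h _ hK] := ffF X Y; exists (h g); rewrite hK. Qed.

(* The inverse of the bijection [fmap F]. *)
Definition ffinv (X Y : C) (g : hom (F X) (F Y)) : hom X Y := xchoose (ff_surj g).

Lemma ffinvK (X Y : C) (g : hom (F X) (F Y)) : fmap F (ffinv g) = g.
Proof. exact/eqP/(xchooseP (ff_surj g)). Qed.

(* The cochain with value F^-1 (a_(F X_0, .., F X_n)), up to the canonical
   isomorphisms [sgL] and [sgR]. *)
Definition DYres_fam n (a : DYfam D n) : DYfam C n := fun s =>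
  ffinv (sgR F s \c a (pmap F s) \c sgLi F s).

Lemma DYres_natural n (a : DYnat D n) : DYres_fam (dyfam a) \in @DYnatb k C n.
Proof.
apply/asboolP => s t f; apply: ff_inj; rewrite !fmapM !ffinvK.
have HL : sgLi F t \c fmap F (tenLm f) = @tenLm D n _ _ (pmapm F f) \c sgLi F s.
  rewrite -[LHS]compm1 -(sgLiK F s) -!compA (compA (fmap F _)) -sgL_nat.
  by rewrite !compA sgLK comp1m.
rewrite -compA HL -!compA (compA (dyfam a _)) (dynatP a) !compA.
by rewrite sgR_nat.
Qed.

Definition DYres_nat n (a : DYnat D n) : DYnat C n := MkDYnat (DYres_natural a).

Lemma DYres_nat_linear n : linear (@DYres_nat n).
Proof.
move=> x a b; apply: dynat_inj => s; rewrite dynat_linear; apply: ff_inj.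
rewrite linF /= !ffinvK.
by rewrite -[LHS]compA comp_is_linearl comp_is_linearr !compA.
Qed.

HB.instance Definition _ n :=
  GRing.isLinear.Build k (DYnat D n) (DYnat C n) *:%R (@DYres_nat n)
    (@DYres_nat_linear n).

Lemma sgm_whisker (A B Z : C) (r : hom A B) A' (f : hom A' (F A))
    A'' (t : hom A'' A') Z' (p : hom Z' (F Z)) :
  fmap F (r \om idm Z) \c (sgm F A Z \c (f \om idm _) \c (t \om p)) =
  sgm F B Z \c ((fmap F r \c f \c t) \om p).
Proof.
by rewrite !compA -sgm_nat fmap1 -!compA -!tenmM !comp1m.
Qed.

Lemma DYres_coface n i (a : DYnat D n) :
  DYres_nat (coface i a) = coface i (DYres_nat a).
Proof.
apply: dynat_inj => s; apply: ff_inj.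
rewrite -[dyfam (DYres_nat _)]/(DYres_fam _) ffinvK.
have shiftL X (f : hom (F (tenL s)) X) g : f \c sgL F s = g -> f = g \c sgLi F s.
  by move=> <-; rewrite -compA sgLiK compm1.
case: i => [|i].
  rewrite !coface_firstE fmapM (shiftL _ _ _ (sgL_head F s)) !(compA (fmap F _)).
  rewrite -sgm_nat fmap1.
  rewrite -[fmap F (dyfam _ _)]/(fmap F (DYres_fam (dyfam a) (s.2 : pow C n.+1))).
  rewrite ffinvK; congr (_ \c _); rewrite compA; congr (_ \c _).
  rewrite -[LHS]compA -[RHS]compA -!tenmM; congr (_ \c (_ \om _)).
  by rewrite -[RHS]compA (sgLK F (s.2 : pow C n.+1)) compm1.
case: (leqP i n) => [le_in|lt_ni].
  rewrite !coface_midE // !fmapM (shiftL _ _ _ (sgL_merge F i s)).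
  rewrite -[fmap F (dyfam _ _)]/(fmap F (DYres_fam (dyfam a) (merge i s))) ffinvK.
  have N := @dynatP _ D n a _ _ (merge_pmap F i s).
  have R := sgR_merge F i s.
  rewrite !compA; congr (_ \c _); congr (_ \c _).
  rewrite -(compA _ (sgLi F _)) sgLK compm1.
  congr (_ \c _); rewrite -[RHS]compA N compA; congr (_ \c _).
  exact: esym R.
rewrite !coface_lastE // !fmapM (shiftL _ _ _ (sgL_last F s)).
have N := @dynatP _ D n a _ _ (pinit_pmap F s).
have R := sgR_last F s.
have G : fmap F (DYres_fam (dyfam a) (pinit s)) \c sgL F (pinit s) =
    sgR F (pinit s) \c dyfam a (pmap F (pinit s)).
  by rewrite ffinvK -compA sgLK compm1.
have := sgm_whisker (DYres_fam (dyfam a) (pinit s)) (sgL F (pinit s))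
  (tenLm (pinit_pmap F s)) (plast_pmap F s).
rewrite {}G -[in RHS](compA (sgR F _)) N (compA (sgR F _)).
rewrite -[plast_pmap F s in RHS]compm1 tenmM => W.
rewrite !compA; do 3!congr (_ \c _).
apply: etrans (congr1 (fun x => x \c _) (esym R)) _.
rewrite -!compA; congr (_ \c _); symmetry.
rewrite !compA in W *; apply: etrans W _.
by rewrite -{1}(comp1m (plast_pmap F s)) tenmM !compA.
Qed.

Lemma DYres_diff n (a : DYnat D n) : DYres_nat (DYdiff a) = DYdiff (DYres_nat a).
Proof.
rewrite /DYdiff linear_sum; apply: eq_bigr => i _.
by rewrite linearZ /= DYres_coface.
Qed.

Definition DYres n : {linear DYC D n -> DYC C n} :=
  match n return {linear DYC D n -> DYC C n} with
  | 0 => \0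
  | m.+1 => @DYres_nat m
  end.

Lemma DYres_d n x : DYres n.+1 (@DYd k D n x) = @DYd k C n (DYres n x).
Proof. by case: n x => [x|n x]; [exact: linear0|exact: DYres_diff]. Qed.

End Restriction.

Definition DYH (k : fieldType) (C : ksemigroupal k) (n : nat) : lmodType k :=
  cohomology (@DYd k C) n.

Definition DYH_restr (k : fieldType) (C : ksemigroupal k) (U : unitalization C)
    (n : nat) : {linear DYH U n -> DYH C n} :=
  @cohomology_map k _ _ _ _ _ (DYres_d (@uincl_linear k C U) (@uincl_ff k C U)) n.

(* Main.v *)
(** Write [I] for the unit. Composing a cochain with the canonical
    rebracketing turns it into natural endomorphisms of the right-bracketed
    tensor products. Between [I] and the objects of [C] there are no nonzero
    morphisms, so cochains on [U] may be prescribed independently on tuples with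
    different first unit position. If a tuple has a unit at position [p], the
    cofaces [p] and [p + 1] of any cochain agree there.

    Hence a cochain on [C], extended by zero to tuples containing a unit, has a
    coboundary of the same kind, so the extension maps cocycles to cocycles and
    the restriction is surjective on cohomology. On the cochains vanishing on
    [C], the map [h] that duplicates the first unit, with sign [(-1)^p], is a
    contraction: in [h d + d h] all terms cancel except three copies of the
    identity with alternating signs. So the restriction is injective on
    cohomology. *)
From mathcomp Require Import all_boot all_order all_algebra.
From mathcomp Require Import boolp.
Require Import Defs.

Set Implicit Arguments.
Unset Strict Implicit.
Unset Printing Implicit Defensive.

Import GRing.Theory.
Local Open Scope ring_scope.

(** * Isomorphisms *)

Section Isos.
Variable C : category.

Lemma iso_id (X : C) : is_iso (idm X).
Proof. by exists (idm X); rewrite comp1m. Qed.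

Lemma iso_comp (X Y Z : C) (g : hom Y Z) (f : hom X Y) :
  is_iso g -> is_iso f -> is_iso (g \c f).
Proof.
move=> [g' [g'g gg']] [f' [f'f ff']]; exists (f' \c g'); split.
  by rewrite compA -(compA f') g'g compm1.
by rewrite compA -(compA g) ff' compm1.
Qed.

Lemma iso_epi (X Y Z : C) (f : hom X Y) (g h : hom Y Z) :
  is_iso f -> g \c f = h \c f -> g = h.
Proof.
move=> [f' [_ ff']] E.
by rewrite -[g]compm1 -ff' compA E -compA ff' compm1.
Qed.

Lemma iso_mono (X Y Z : C) (f : hom Y Z) (g h : hom X Y) :
  is_iso f -> f \c g = f \c h -> g = h.
Proof.
move=> [f' [f'f _]] E.
by rewrite -[g]comp1m -f'f -compA E compA f'f comp1m.
Qed.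

Lemma iso_factor (X Y Z : C) (g : hom Y Z) (f : hom X Y) :
  is_iso g -> is_iso (g \c f) -> is_iso f.
Proof.
move=> [g' [g'g gg']] [h [hgf gfh]]; exists (h \c g); split.
  by rewrite -compA.
have E : f = g' \c (g \c f) by rewrite compA g'g comp1m.
by rewrite E -compA (compA _ h) gfh comp1m.
Qed.

Definition isoinv (X Y : C) (f : hom X Y) (If : is_iso f) : hom Y X :=
  projT1 (cid If).

Lemma isoinvK (X Y : C) (f : hom X Y) (If : is_iso f) : isoinv If \c f = idm X.
Proof. by rewrite /isoinv; case: cid => g []. Qed.

Lemma isoinvKV (X Y : C) (f : hom X Y) (If : is_iso f) : f \c isoinv If = idm Y.
Proof. by rewrite /isoinv; case: cid => g []. Qed.

Lemma isomorphic_trans (X Y Z : C) :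
  isomorphic X Y -> isomorphic Y Z -> isomorphic X Z.
Proof. by move=> [f If] [g Ig]; exists (g \c f); exact: iso_comp. Qed.

End Isos.

Lemma equivalence_faithful (C D : category) (F : functor C D) (X Y : C)
    (f g : hom X Y) : is_equivalence F -> fmap F f = fmap F g -> f = g.
Proof.
move=> [G [[e [Ie En]] _]] E; apply: (iso_epi (Ie X)).
by have := En _ _ f; have := En _ _ g; rewrite /= E => <-.
Qed.

(** The preimage is [G h] conjugated by the natural isomorphism from [GF] to the identity. Since [G]
    is an equivalence too, it is faithful, and it suffices to compare after applying [G]. *)
Lemma equivalence_full (C D : category) (F : functor C D) (X Y : C)
    (h : hom (F X) (F Y)) : is_equivalence F -> exists f, fmap F f = h.
Proof.
move=> FE; have [G [[e [Ie En]] Ge]] := FE.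
have FG : is_equivalence G by exists F; split=> //; exists e.
exists (e Y \c fmap G h \c isoinv (Ie X)).
apply: (equivalence_faithful FG); apply: (iso_mono (Ie Y)).
by have /= -> := En _ _ (e Y \c fmap G h \c isoinv (Ie X)); rewrite -compA isoinvK compm1.
Qed.

(** * Rebracketing *)

Section Coherence.
Variable C : semigroupal.

Lemma iso_tenm (X X' Y Y' : C) (f : hom X X') (g : hom Y Y') :
  is_iso f -> is_iso g -> is_iso (f \om g).
Proof.
move=> [f' [f'f ff']] [g' [g'g gg']]; exists (f' \om g').
by rewrite -!tenmM f'f g'g ff' gg' !tenm1.
Qed.

Lemma iso_assoc (X Y Z : C) : is_iso (assoc X Y Z).
Proof. by exists (associ X Y Z); rewrite assocK associK. Qed.

Lemma tenm_exchange (X X' Y Y' : C) (f : hom X X') (g : hom Y Y') :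
  (f \om idm Y') \c (idm X \om g) = (idm X' \om g) \c (f \om idm Y).
Proof. by rewrite -!tenmM !comp1m !compm1. Qed.

Lemma tenmMl (X X' X'' A : C) (g : hom X' X'') (f : hom X X') :
  (g \c f) \om idm A = (g \om idm A) \c (f \om idm A).
Proof. by rewrite -tenmM comp1m. Qed.

Lemma tenmMr (X X' X'' A : C) (g : hom X' X'') (f : hom X X') :
  idm A \om (g \c f) = (idm A \om g) \c (idm A \om f).
Proof. by rewrite -tenmM comp1m. Qed.

Lemma mergeR_iso i n (s : pow C n.+2) : is_iso (mergeR i s).
Proof.
elim: i n s => [|i IH] [|n] s /=; [exact: iso_id|exact: iso_assoc|exact: iso_id|].
exact: iso_tenm (iso_id _) (IH _ _).
Qed.

Lemma lastR_iso n (s : pow C n.+2) : is_iso (lastR s).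
Proof.
elim: n s => [|n IH] s /=; first exact: iso_id.
exact: iso_comp (iso_tenm (iso_id _) (IH _)) (iso_assoc _ _ _).
Qed.

(** The recursion follows that of [tenL], merging the two leading objects, so each step contributes
    the single associator [mergeR 0]. *)
Fixpoint rebracket n : forall s : pow C n.+1, hom (tenL s) (tenR s) :=
  match n with
  | 0 => fun s => idm s.1
  | m.+1 => fun s => mergeR 0 s \c @rebracket m (s.1 \ox s.2.1, s.2.2)
  end.

Lemma rebracket_iso n (s : pow C n.+1) : is_iso (rebracket s).
Proof.
elim: n s => [|n IH] s; first exact: iso_id.
exact: iso_comp (mergeR_iso 0 s) (IH _).
Qed.

Lemma rebracket_nat n (s t : pow C n.+1) (f : phom s t) :
  rebracket t \c tenLm f = tenRm f \c rebracket s.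
Proof.
elim: n s t f => [|n IH] s t f; first by rewrite /= comp1m compm1.
have E := IH (merge 0 s) (merge 0 t) (mergem 0 f).
apply: etrans (esym (compA _ _ _)) _.
apply: etrans (congr1 (comp _) E) _.
apply: etrans (compA _ _ _) _.
apply: etrans (congr1 (comp^~ _) (mergeR_nat 0 f)) _.
exact: esym (compA _ _ _).
Qed.

(** The equation [M] is the pentagon for [A], [B], [D] and the remaining tensor product; naturality
    of [rebracket] then carries the associator from the left-bracketed to the right-bracketed
    side. *)
Lemma rebracket_assocL n (A B D : C) (t : pow C n) :
  mergeR 1 ((A, (B, (D, t))) : pow C n.+3) \c
    @rebracket n.+1 (A, (B \ox D, t)) \c assocL A B D t =
  @rebracket n.+2 (A, (B, (D, t))).
Proof.
have M : mergeR 1 ((A, (B, (D, t))) : pow C n.+3) \c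
    mergeR 0 ((A, (B \ox D, t)) : pow C n.+2) \c
    @tenRm C n ((A \ox B) \ox D, t) (A \ox (B \ox D), t) (assoc A B D, pid t) =
    mergeR 0 ((A, (B, (D, t))) : pow C n.+3) \c
    mergeR 0 ((A \ox B, (D, t)) : pow C n.+2).
  case: n t => [|n] t; first by rewrite /= tenm1 !comp1m compm1.
  by rewrite /= (@tenRm1 C n t) -pentagon.
have N := @rebracket_nat n ((A \ox B) \ox D, t) (A \ox (B \ox D), t)
  (assoc A B D, pid t).
transitivity (mergeR 1 ((A, (B, (D, t))) : pow C n.+3) \c
    mergeR 0 ((A, (B \ox D, t)) : pow C n.+2) \c
  (@rebracket n (A \ox (B \ox D), t) \c assocL A B D t)); first by rewrite /= -!compA.
rewrite [X in _ \c X]N compA M; exact: esym (compA _ _ _).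
Qed.

(** This is the instance of coherence behind the middle cofaces. Index 0 holds by definition, index
    1 is the pentagon, and for larger indices the two leading objects are merged first, using
    naturality of the associator. *)
Lemma rebracket_merge i n (s : pow C n.+2) :
  mergeR i s \c rebracket (merge i s) \c mergeL i s = rebracket s.
Proof.
elim: i n s => [|i IH] n s; first exact: compm1.
case: n s => [|n] s; first by rewrite /= !compm1.
case: i IH => [|i] IH.
  case: s => A [B [D t]]; exact: (@rebracket_assocL n A B D t).
case: n s => [|n] s.
  by case: s => A [B [D []]]; exact: (@rebracket_assocL 0 A B D tt).
have E := IH n.+1 (s.1 \ox s.2.1, s.2.2).
apply: etrans _ (congr1 (comp (mergeR 0 s)) E).
rewrite /= !compA; congr (_ \c _); congr (_ \c _).
by rewrite -[idm (s.1 \ox _)]tenm1 assoc_nat.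
Qed.

Lemma rebracket_head n (s : pow C n.+2) :
  (idm s.1 \om rebracket (s.2 : pow C n.+1)) \c headL s = rebracket s.
Proof.
elim: n s => [|n IH] s; first by rewrite /= tenm1 !comp1m.
case: s => A [B [D t]]; rewrite -(@rebracket_assocL n A B D t).
by rewrite -(IH (A, (B \ox D, t))) /= tenmMr -!compA.
Qed.

(** The pentagon again; it supplies the induction step for splitting off the last object. *)
Lemma mergeR_lastR n (s : pow C n.+3) :
  mergeR 0 s \c lastR (merge 0 s) =
  lastR s \c (mergeR 0 (pinit s) \om idm (plast s)).
Proof.
case: n s => [|n] [A [B s]].
  by rewrite /= !tenm1 !compm1 comp1m.
rewrite /= compA -[idm (A \ox B)]tenm1 assoc_nat -compA pentagon.
by rewrite !compA -tenmMr.
Qed.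

Lemma rebracket_last n (s : pow C n.+2) :
  lastR s \c (rebracket (pinit s) \om idm (plast s)) \c lastL s = rebracket s.
Proof.
elim: n s => [|n IH] s; first by rewrite /= tenm1 !comp1m.
transitivity (mergeR 0 s \c rebracket (merge 0 s)); last by [].
rewrite -(IH (merge 0 s)) !compA mergeR_lastR; congr (_ \c _).
rewrite -[RHS]compA; congr (_ \c _); exact: tenmMl.
Qed.

End Coherence.

Lemma equivalence_iso (C D : category) (F : functor C D) (X Y : C)
    (f : hom X Y) : is_equivalence F -> is_iso (fmap F f) -> is_iso f.
Proof.
move=> FE [h [hf fh]]; have [g Eg] := equivalence_full h FE.
by exists g; split; apply: (equivalence_faithful FE);
  rewrite fmapM fmap1 Eg ?hf ?fh.
Qed.

(** * Unit constraints from a weak unit *)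

Section Unitors.
Variables (C : semigroupal) (I : C).
Hypothesis unitI : is_unit I.

Lemma rten_equivalence : is_equivalence (rtenF I).
Proof. by case: unitI. Qed.

Lemma lten_equivalence : is_equivalence (ltenF I).
Proof. by case: unitI. Qed.

Lemma unit_mul_ex : exists f : hom (I \ox I) I, is_iso f.
Proof. by case: unitI. Qed.

Definition unit_mul : hom (I \ox I) I := projT1 (cid unit_mul_ex).

Lemma unit_mul_iso : is_iso unit_mul.
Proof. by rewrite /unit_mul; case: cid. Qed.

(** A weak unit comes without unitors. Multiplying the two units of [I \ox (I \ox X)] gives a
    morphism that fullness of [I \ox -] lifts to a left unitor at [X]; the right unitor arises
    symmetrically. *)
Lemma lam_ex (X : C) : exists f : hom (I \ox X) X,
  idm I \om f = (unit_mul \om idm X) \c associ I I X.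
Proof.
exact: (@equivalence_full _ _ (ltenF I) (I \ox X) X _ lten_equivalence).
Qed.

Lemma rho_ex (X : C) : exists f : hom (X \ox I) X,
  f \om idm I = (idm X \om unit_mul) \c assoc X I I.
Proof.
exact: (@equivalence_full _ _ (rtenF I) (X \ox I) X _ rten_equivalence).
Qed.

Definition lam (X : C) : hom (I \ox X) X := projT1 (cid (lam_ex X)).
Definition rho (X : C) : hom (X \ox I) X := projT1 (cid (rho_ex X)).

Lemma lamE (X : C) : idm I \om lam X = (unit_mul \om idm X) \c associ I I X.
Proof. by rewrite /lam; case: cid. Qed.

Lemma rhoE (X : C) : rho X \om idm I = (idm X \om unit_mul) \c assoc X I I.
Proof. by rewrite /rho; case: cid. Qed.

Lemma lten_inj (X Y : C) (f g : hom X Y) : idm I \om f = idm I \om g -> f = g.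
Proof. exact: (equivalence_faithful lten_equivalence). Qed.

Lemma rten_inj (X Y : C) (f g : hom X Y) : f \om idm I = g \om idm I -> f = g.
Proof. exact: (equivalence_faithful rten_equivalence). Qed.

Lemma iso_associ (X Y Z : C) : is_iso (associ X Y Z).
Proof. by exists (assoc X Y Z); rewrite assocK associK. Qed.

Lemma lam_iso (X : C) : is_iso (lam X).
Proof.
apply: (equivalence_iso lten_equivalence).
rewrite /= lamE; apply: iso_comp (iso_associ _ _ _).
exact: iso_tenm unit_mul_iso (iso_id _).
Qed.

Lemma rho_iso (X : C) : is_iso (rho X).
Proof.
apply: (equivalence_iso rten_equivalence).
rewrite /= rhoE; apply: iso_comp (iso_assoc _ _ _).
exact: iso_tenm (iso_id _) unit_mul_iso.
Qed.

Lemma associ_nat (X X' Y Y' Z Z' : C) (f : hom X X') (g : hom Y Y') (h : hom Z Z') :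
  associ X' Y' Z' \c (f \om (g \om h)) = ((f \om g) \om h) \c associ X Y Z.
Proof.
apply: (iso_mono (iso_assoc _ _ _)); apply: (iso_epi (iso_assoc _ _ _)).
by rewrite compA associK comp1m -!compA assocK compm1 assoc_nat.
Qed.

Lemma lam_nat (X Y : C) (f : hom X Y) : f \c lam X = lam Y \c (idm I \om f).
Proof.
apply: lten_inj; rewrite !tenmMr !lamE compA -tenm_exchange -!compA.
by rewrite -{1}[idm (I \ox I)]tenm1 associ_nat.
Qed.

Lemma rho_nat (X Y : C) (f : hom X Y) : f \c rho X = rho Y \c (f \om idm I).
Proof.
apply: rten_inj; rewrite !tenmMl !rhoE compA tenm_exchange -!compA.
by rewrite assoc_nat tenm1.
Qed.

(** By faithfulness of [I \ox -] the claim may be checked after tensoring with [I], where [lam]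
    becomes [unit_mul] and the pentagon closes the diagram. *)
Lemma lam_ten (X Y : C) : lam (X \ox Y) \c assoc I X Y = lam X \om idm Y.
Proof.
apply: lten_inj; rewrite tenmMr lamE; apply: (iso_epi (iso_assoc _ _ _)).
rewrite -assoc_nat lamE.
apply: (iso_epi (f := assoc I I X \om idm Y)).
  exact: iso_tenm (iso_assoc _ _ _) (iso_id _).
rewrite -[RHS]compA -tenmMl -(compA (unit_mul \om idm X)) assocK compm1.
rewrite assoc_nat tenm1 -!compA; congr (_ \c _).
rewrite (compA (idm I \om _)) -pentagon.
by rewrite compA assocK comp1m.
Qed.

Lemma rho_ten (X Y : C) : (idm X \om rho Y) \c assoc X Y I = rho (X \ox Y).
Proof.
apply: rten_inj; rewrite tenmMl rhoE; apply: (iso_mono (iso_assoc _ _ _)).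
rewrite compA assoc_nat rhoE tenmMr -!compA.
rewrite (compA (idm X \om assoc _ _ _)) -pentagon !compA.
by rewrite -[idm (X \ox Y)]tenm1 assoc_nat.
Qed.

(* Both sides agree after precomposition with [id \ox lam Y], which is
   [rho X \ox id] up to associativity: each cancels the two middle units
   against each other. *)
Lemma lam_rho (X Y : C) : (idm X \om lam Y) \c assoc X I Y = rho X \om idm Y.
Proof.
have E : assoc X I Y \c (idm (X \ox I) \om lam Y) = rho X \om idm (I \ox Y).
  rewrite -[idm (X \ox I)]tenm1 assoc_nat lamE tenmMr.
  apply: (iso_epi (iso_assoc (X \ox I) I Y)).
  rewrite -compA pentagon -[idm (I \ox Y)]tenm1 -assoc_nat rhoE tenmMl.
  rewrite [RHS]compA assoc_nat -!compA; congr (_ \c _).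
  by rewrite !compA -tenmMr assocK tenm1 comp1m.
apply: (iso_epi (f := idm (X \ox I) \om lam Y)).
  exact: iso_tenm (iso_id _) (lam_iso _).
by rewrite -compA E tenm_exchange.
Qed.

End Unitors.

(** Induction step for [ins_last]: a square about the tail of a tuple stays commutative when a
    further object [X] is tensored on the left. *)
Lemma tenm_assoc_square (C : semigroupal) (X P P1 P2 Z Z' T T' : C)
    (l : hom (P \ox Z) T) (i : hom P1 P) (f : hom P2 P1) (g : hom Z' Z)
    (r : hom T' T) (l' : hom (P2 \ox Z') T') :
  l \c (i \om idm Z) \c (f \om g) = r \c l' ->
  (idm X \om l) \c assoc X P Z \c ((idm X \om i) \om idm Z)
    \c ((idm X \om f) \om g) =
  (idm X \om r) \c ((idm X \om l') \c assoc X P2 Z').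
Proof.
move=> E; rewrite [RHS]compA -tenmMr -E !tenmMr -!compA.
by rewrite -assoc_nat (compA (assoc X P Z)) assoc_nat !compA.
Qed.

(** * Inserting and deleting units in a tuple *)

Section Tuples.
Variables (C : semigroupal) (I : C).
Hypothesis unitI : is_unit I.
Local Notation lam := (lam unitI).
Local Notation rho := (rho unitI).

(* The index of the first unit object, or [n] if there is none. *)
Fixpoint pos n : pow C n -> nat :=
  match n with
  | 0 => fun _ => 0%N
  | m.+1 => fun s => if `[< isomorphic s.1 I >] then 0%N else (@pos m s.2).+1
  end.

Lemma pos_le n (s : pow C n) : (pos s <= n)%N.
Proof. by elim: n s => [|n IH] s //=; case: asboolP => // _; exact: IH. Qed.

Lemma pos_pinit n (s : pow C n.+1) : pos (pinit s) = minn (pos s) n.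
Proof.
elim: n s => [|n IH] s /=; first by rewrite minn0.
by rewrite IH /=; case: asboolP => _; rewrite ?min0n ?minnSS.
Qed.

Section PosMerge.
Hypothesis nonunit_ten : forall X Y : C,
  ~ isomorphic X I -> ~ isomorphic Y I -> ~ isomorphic (X \ox Y) I.

(** Both merged objects stand before the first unit, so their product is again a nonunit and the
    unit moves one place forward. *)
Lemma pos_merge_lt j n (s : pow C n.+2) :
  (j <= n)%N -> (j.+1 < pos s)%N -> pos (merge j s) = (pos s).-1.
Proof.
elim: j n s => [|j IH] [|n] s //= jn; case: asboolP => //= uA.
- case: asboolP => //= uB _.
  by case: asboolP => // /(nonunit_ten uA uB).
- case: asboolP => //= uB _.
  by case: asboolP => // /(nonunit_ten uA uB).
rewrite ltnS => js; have E := IH n s.2 jn js.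
apply: etrans (congr1 S E) _; rewrite prednK //; exact: ltn_trans js.
Qed.

Lemma pos_merge_gt j n (s : pow C n.+2) :
  (j <= n)%N -> (pos s < j)%N -> pos (merge j s) = pos s.
Proof.
elim: j n s => [|j IH] [|n] s //= jn; case: asboolP => //= uA.
by rewrite ltnS => js; exact: (congr1 S (IH n s.2 jn js)).
Qed.

End PosMerge.

(** Indices above [n.+1] are treated as [n.+1], here and in [del]. *)
Fixpoint nth_obj p n : pow C n.+2 -> C :=
  match p with
  | 0 => fun s => s.1
  | q.+1 => match n return pow C n.+2 -> C with
            | 0 => fun s => s.2.1
            | m.+1 => fun s => @nth_obj q m s.2
            end
  end.

Fixpoint del p n : pow C n.+2 -> pow C n.+1 :=
  match p with
  | 0 => fun s => s.2
  | q.+1 => match n return pow C n.+2 -> pow C n.+1 with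
            | 0 => fun s => (s.1, tt)
            | m.+1 => fun s => (s.1, @del q m s.2)
            end
  end.

(** The unit is absorbed by its right neighbour through [lam]; only in the last slot is it absorbed
    by its left neighbour, through [rho]. *)
Fixpoint delm p n : forall s : pow C n.+2,
    hom (nth_obj p s) I -> hom (tenR s) (tenR (del p s)) :=
  match p return forall s : pow C n.+2,
    hom (nth_obj p s) I -> hom (tenR s) (tenR (del p s)) with
  | 0 => fun s e => lam (@tenR C n s.2) \c (e \om idm _)
  | q.+1 =>
      match n return forall s : pow C n.+2,
        hom (nth_obj q.+1 s) I -> hom (tenR s) (tenR (del q.+1 s)) with
      | 0 => fun s e => rho s.1 \c (idm s.1 \om e)
      | m.+1 => fun s e => idm s.1 \om @delm q m s.2 e
      end
  end.

Lemma delm_iso p n (s : pow C n.+2) (e : hom (nth_obj p s) I) :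
  is_iso e -> is_iso (delm e).
Proof.
move=> Ie; elim: p n s e Ie => [|p IH] n s e Ie /=.
  exact: iso_comp (lam_iso _ _) (iso_tenm Ie (iso_id _)).
case: n s e Ie => [|n] s e Ie.
  exact: iso_comp (rho_iso _ _) (iso_tenm (iso_id _) Ie).
exact: iso_tenm (iso_id _) (IH _ _ _ Ie).
Qed.

(** Once the unit is merged with its right neighbour, deleting it acts on that one object, by [lam];
    this is [lam_ten]. The morphism of tuples [f] is what naturality of a cochain can be applied
    to. *)
Lemma delm_mergeR p n (s : pow C n.+2) (e : hom (nth_obj p s) I) : (p <= n)%N ->
  exists f : phom (merge p s) (del p s), delm e \c mergeR p s = tenRm f.
Proof.
elim: p n s e => [|p IH] [|n] s e pn //=.
- by exists (lam s.2.1 \c (e \om idm _), tt); rewrite compm1.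
- exists (lam s.2.1 \c (e \om idm _), pid (s.2.2 : pow C n.+1)).
  rewrite /= (@tenRm1 C n s.2.2) tenmMl -lam_ten -!compA assoc_nat.
  by rewrite tenm1.
have [f Ef] := IH n s.2 e pn; exists (idm s.1, f).
by rewrite /= -Ef tenmMr.
Qed.

(** The same for the left neighbour, where the triangle identity [lam_rho] exchanges [lam] for
    [rho]. *)
Lemma delmS_mergeR p n (s : pow C n.+2) (e : hom (nth_obj p.+1 s) I) : (p <= n)%N ->
  exists f : phom (merge p s) (del p.+1 s), delm e \c mergeR p s = tenRm f.
Proof.
elim: p n s e => [|p IH] [|n] s e pn //=.
- by exists (rho s.1 \c (idm _ \om e), tt); rewrite compm1.
- exists (rho s.1 \c (idm _ \om e), pid (s.2.2 : pow C n.+1)).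
  rewrite /= (@tenRm1 C n s.2.2) tenmMr tenmMl -lam_rho -!compA.
  by rewrite assoc_nat.
have [f Ef] := IH n s.2 e pn; exists (idm s.1, f).
by rewrite /= -Ef tenmMr.
Qed.

Lemma delm_lastR n (s : pow C n.+2) (e : hom (nth_obj n.+1 s) I) :
  exists f : phom (pinit s) (del n.+1 s), exists e' : hom (plast s) I,
  delm e \c lastR s = rho _ \c (tenRm f \om e').
Proof.
elim: n s e => [|n IH] s e /=.
  by exists (idm s.1, tt), e; rewrite compm1.
have [f [e' E]] := IH s.2 e; exists (idm s.1, f), e'.
rewrite /= compA -tenmMr [X in idm _ \om X]E tenmMr -compA -assoc_nat compA.
by rewrite rho_ten.
Qed.

(** An index above [n] is treated as [n], so the new unit always has a right neighbour and [insm]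
    can be built from [lam] alone. *)
Fixpoint ins p n : pow C n.+1 -> pow C n.+2 :=
  match p with
  | 0 => fun s => (I, s)
  | q.+1 => match n return pow C n.+1 -> pow C n.+2 with
            | 0 => fun s => (I, s)
            | m.+1 => fun s => (s.1, @ins q m s.2)
            end
  end.

Fixpoint insm p n : forall s : pow C n.+1, hom (tenR (ins p s)) (tenR s) :=
  match p return forall s : pow C n.+1, hom (tenR (ins p s)) (tenR s) with
  | 0 => fun s => lam (tenR s)
  | q.+1 => match n return forall s : pow C n.+1,
                hom (tenR (ins q.+1 s)) (tenR s) with
            | 0 => fun s => lam s.1
            | m.+1 => fun s => idm s.1 \om @insm q m s.2
            end
  end.

Fixpoint pins p n : forall s t : pow C n.+1, phom s t ->
    phom (ins p s) (ins p t) :=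
  match p return forall s t : pow C n.+1, phom s t ->
    phom (ins p s) (ins p t) with
  | 0 => fun s t f => (idm I, f)
  | q.+1 => match n return forall s t : pow C n.+1, phom s t ->
               phom (ins q.+1 s) (ins q.+1 t) with
            | 0 => fun s t f => (idm I, f)
            | m.+1 => fun s t f => (f.1, @pins q m s.2 t.2 f.2)
            end
  end.

Lemma insm_iso p n (s : pow C n.+1) : is_iso (insm p s).
Proof.
elim: p n s => [|p IH] [|n] s /=; try exact: lam_iso.
exact: iso_tenm (iso_id _) (IH _ _).
Qed.

Lemma insm_nat p n (s t : pow C n.+1) (f : phom s t) :
  tenRm f \c insm p s = insm p t \c tenRm (pins p f).
Proof.
elim: p n s t f => [|p IH] [|n] s t f /=; try exact: lam_nat.
by rewrite -!tenmM IH comp1m compm1.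
Qed.

Lemma at_ins p n (s : pow C n.+1) : (p <= n)%N -> nth_obj p (ins p s) = I.
Proof. by elim: p n s => [|p IH] [|n] s //= pn; exact: IH. Qed.

Lemma at_pos n (s : pow C n.+2) : (pos s < n.+2)%N -> isomorphic (nth_obj (pos s) s) I.
Proof.
elim: n s => [|n IH] s.
  by move=> /=; case: asboolP => //= _; case: asboolP.
rewrite /=; case: asboolP => //= _; rewrite ltnS; exact: IH.
Qed.

Lemma at_ins_pos n (s : pow C n.+1) : (pos s < n.+1)%N ->
  isomorphic (nth_obj (pos s).+1 (ins (pos s) s)) I.
Proof.
elim: n s => [|n IH] s; rewrite [pos s]/=; first by case: asboolP.
case: asboolP => //= _; rewrite ltnS; exact: IH.
Qed.

Lemma ins_merge_at p n (s : pow C n.+1) : (p <= n)%N ->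
  exists f : phom (merge p (ins p s)) s,
  insm p s \c mergeR p (ins p s) = tenRm f.
Proof.
elim: p n s => [|p IH] [|n] s pn //=.
- by exists (lam s.1, tt); rewrite compm1.
- exists (lam s.1, pid (s.2 : pow C n.+1)).
  by rewrite /= (@tenRm1 C n s.2) lam_ten.
have [f Ef] := IH n s.2 pn; exists (idm s.1, f).
by rewrite /= -Ef tenmMr.
Qed.

(** Insertion commutes with a merge elsewhere. The two resulting tuples agree only after case
    analysis on the indices, so here and in the next lemma an identity morphism of tuples [f] takes
    the place of a transport. *)
Lemma ins_merge_lt j p n (s : pow C n.+2) : (j < p)%N -> (p <= n)%N ->
  exists f : phom (merge j (ins p.+1 s)) (ins p (merge j s)),
  mergeR j s \c insm p (merge j s) \c tenRm f =
  insm p.+1 s \c mergeR j (ins p.+1 s).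
Proof.
elim: j p n s => [|j IH] [|p] [|n] s //= jp pn.
  exists (idm _, pid (ins p s.2.2)).
  have E := @tenRm1 C n.+1 (ins p s.2.2).
  rewrite /= in E *; rewrite E tenm1 compm1 -[idm (s.1 \ox _)]tenm1.
  by rewrite assoc_nat.
have [f Ef] := IH p n s.2 jp pn; exists (idm s.1, f).
by rewrite /= -!tenmMr Ef.
Qed.

Lemma ins_merge_gt j p n (s : pow C n.+2) : (p < j)%N -> (j <= n)%N ->
  exists f : phom (merge j.+1 (ins p s)) (ins p (merge j s)),
  mergeR j s \c insm p (merge j s) \c tenRm f =
  insm p s \c mergeR j.+1 (ins p s).
Proof.
elim: j p n s => [|j IH] [|p] n s // jp jn.
  exists (pid (_ : pow C n.+2)).
  by rewrite tenRm1 compm1 lam_nat.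
case: n s jn => [|n] s jn //.
have [f Ef] := IH p n s.2 jp jn; exists (idm s.1, f).
rewrite /= in Ef *; by rewrite -!tenmMr Ef.
Qed.

Lemma ins_last p n (s : pow C n.+2) : (p <= n)%N ->
  exists f : phom (pinit (ins p s)) (ins p (pinit s)),
  exists g : hom (plast (ins p s)) (plast s),
  lastR s \c (insm p (pinit s) \om idm (plast s)) \c (tenRm f \om g) =
  insm p s \c lastR (ins p s).
Proof.
elim: p n s => [|p IH] n s pn.
  exists (pid (_ : pow C n.+2)), (idm _).
  rewrite tenRm1 tenm1 compm1 /= compA -lam_nat -compA.
  by rewrite lam_ten.
case: n s pn => [|n] s pn //.
have [f [g E]] := IH n s.2 pn; exists (idm s.1, f), g.
exact: (@tenm_assoc_square _ s.1 _ _ _ _ _ _ _ _ _ _ _ _ _ E).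
Qed.

End Tuples.

(** * Cochains as endomorphisms *)

Section Bilinearity.
Variables (k : fieldType) (C : ksemigroupal k).

Lemma compZm (X Y Z : C) c (g : hom Y Z) (f : hom X Y) :
  (c *: g) \c f = c *: (g \c f).
Proof. by have := comp_is_linearl f c g 0; rewrite addr0 comp0m addr0. Qed.

Lemma compmZ (X Y Z : C) c (g : hom Y Z) (f : hom X Y) :
  g \c (c *: f) = c *: (g \c f).
Proof. by have := comp_is_linearr g c f 0; rewrite addr0 compm0 addr0. Qed.

Lemma tenm_idZ (A X Y : C) c (f : hom X Y) :
  idm A \om (c *: f) = c *: (idm A \om f).
Proof.
have E := tenm_is_linearr A (-1) (0 : hom X Y) 0.
have Z : idm A \om (0 : hom X Y) = 0.
  by rewrite !scaleN1r oppr0 add0r addNr in E.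
by have := tenm_is_linearr A c f 0; rewrite addr0 Z addr0.
Qed.

Lemma tenmZ_id (A X Y : C) c (f : hom X Y) :
  (c *: f) \om idm A = c *: (f \om idm A).
Proof.
have E := tenm_is_linearl A (-1) (0 : hom X Y) 0.
have Z : (0 : hom X Y) \om idm A = 0.
  by rewrite !scaleN1r oppr0 add0r addNr in E.
by have := tenm_is_linearl A c f 0; rewrite addr0 Z addr0.
Qed.

Lemma ten0m (X Y X' Y' : C) (f : hom X' Y') : (0 : hom X Y) \om f = 0.
Proof.
rewrite -[f]comp1m -[0](compm1 (0 : hom X Y)) tenmM.
by rewrite -(scale0r (0 : hom X Y)) tenmZ_id scale0r comp0m.
Qed.

Lemma tenm0 (X Y X' Y' : C) (f : hom X' Y') : f \om (0 : hom X Y) = 0.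
Proof.
rewrite -[f]compm1 -[0](comp1m (0 : hom X Y)) tenmM.
by rewrite -(scale0r (0 : hom X Y)) tenm_idZ scale0r compm0.
Qed.

Lemma comp_suml (X Y Z : C) (f : hom X Y) n (F : 'I_n -> hom Y Z) :
  (\sum_i F i) \c f = \sum_i (F i \c f).
Proof.
elim/big_rec2: _ => [|i x y _ <-]; first exact: comp0m.
by have := comp_is_linearl f 1 (F i) y; rewrite !scale1r.
Qed.

Lemma comp_sumr (X Y Z : C) (g : hom Y Z) n (F : 'I_n -> hom X Y) :
  g \c (\sum_i F i) = \sum_i (g \c F i).
Proof.
elim/big_rec2: _ => [|i x y _ <-]; first exact: compm0.
by have := comp_is_linearr g 1 (F i) y; rewrite !scale1r.
Qed.

End Bilinearity.

Section RightCochains.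
Variables (k : fieldType) (C : ksemigroupal k).

Lemma rend_ex n (a : DYnat C n) (s : pow C n.+1) :
  exists e : hom (tenR s) (tenR s), e \c rebracket s = dyfam a s.
Proof.
exists (dyfam a s \c isoinv (rebracket_iso s)).
by rewrite -compA isoinvK compm1.
Qed.

(* The cochain [a], with its source rebracketed to the right. *)
Definition rend n (a : DYnat C n) (s : pow C n.+1) : hom (tenR s) (tenR s) :=
  projT1 (cid (rend_ex a s)).

Lemma rend_rebracket n (a : DYnat C n) s : rend a s \c rebracket s = dyfam a s.
Proof. by rewrite /rend; case: cid. Qed.

Lemma rend_eq n (a : DYnat C n) s e : e \c rebracket s = dyfam a s -> rend a s = e.
Proof. by move=> E; apply: (iso_epi (rebracket_iso s)); rewrite rend_rebracket E. Qed.

Lemma rend_nat n (a : DYnat C n) s t (f : phom s t) :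
  rend a t \c tenRm f = tenRm f \c rend a s.
Proof.
apply: (iso_epi (rebracket_iso s)); rewrite -!compA -rebracket_nat.
by rewrite (compA (rend a t)) !rend_rebracket; exact: dynatP.
Qed.

Lemma dyfam_sum n m (c : 'I_m -> k) (a : 'I_m -> DYnat C n) s :
  dyfam (\sum_i c i *: a i) s = \sum_i c i *: dyfam (a i) s.
Proof.
elim/big_rec2: _ => [//|i x y _ <-]; exact: dynat_linear.
Qed.

Lemma rend_diff n (a : DYnat C n) s :
  rend (DYdiff a) s = \sum_(i < n.+3) (-1) ^+ i *: rend (coface i a) s.
Proof.
apply: rend_eq; rewrite dyfam_sum comp_suml; apply: eq_bigr => i _.
by rewrite compZm rend_rebracket.
Qed.

Lemma rend_coface0 n (a : DYnat C n) s :
  rend (coface 0 a) s = idm s.1 \om rend a (s.2 : pow C n.+1).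
Proof.
apply: rend_eq; rewrite coface_firstE -rebracket_head compA -tenmMr.
by rewrite rend_rebracket.
Qed.

(** By [rebracket_merge] the left bracketings drop out, and a middle coface becomes conjugation by
    [mergeR i s], written without an inverse. *)
Lemma rend_coface_merge n i (a : DYnat C n) s : (i <= n)%N ->
  rend (coface i.+1 a) s \c mergeR i s = mergeR i s \c rend a (merge i s).
Proof.
move=> le_in.
(* Composed with the isomorphism [mergeR i s], this map is the isomorphism [rebracket s]; so it is
   invertible and may be cancelled on the right. *)
have I1 : is_iso (rebracket (merge i s) \c mergeL i s).
  apply: iso_factor (mergeR_iso i s) _; rewrite compA rebracket_merge.
  exact: rebracket_iso.
apply: (iso_epi I1); rewrite -!compA (compA (mergeR i s)) rebracket_merge rend_rebracket.
by rewrite coface_midE // (compA (rend a _)) rend_rebracket !compA.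
Qed.

Lemma rend_coface_last n i (a : DYnat C n) s : (n < i)%N ->
  rend (coface i.+1 a) s \c lastR s =
  lastR s \c (rend a (pinit s) \om idm (plast s)).
Proof.
move=> lt_ni; have I1 : is_iso ((rebracket (pinit s) \om idm (plast s)) \c lastL s).
  apply: iso_factor (lastR_iso s) _; rewrite compA rebracket_last.
  exact: rebracket_iso.
apply: (iso_epi I1); rewrite -!compA (compA (lastR s)) rebracket_last rend_rebracket.
by rewrite coface_lastE // (compA (_ \om _)) -tenmMl rend_rebracket !compA.
Qed.

Section Make.
Variables (n : nat) (e : forall s : pow C n.+1, hom (tenR s) (tenR s)).
Hypothesis e_nat : forall (s t : pow C n.+1) (f : phom s t),
  e t \c tenRm f = tenRm f \c e s.

Lemma mkrend_natural : (fun s => e s \c rebracket s) \in @DYnatb k C n.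
Proof.
by apply/asboolP => s t f; rewrite -compA rebracket_nat !compA e_nat.
Qed.

Definition mkrend : DYnat C n := MkDYnat mkrend_natural.

Lemma rend_mkrend s : rend mkrend s = e s.
Proof. exact: rend_eq. Qed.

End Make.

Lemma rend_inj n (a b : DYnat C n) : (forall s, rend a s = rend b s) -> a = b.
Proof. by move=> E; apply: dynat_inj => s; rewrite -!rend_rebracket E. Qed.

(** The tuple at which [coface i a] evaluates [a]. *)
Definition face i n (s : pow C n.+2) : pow C n.+1 :=
  match i with
  | 0 => s.2
  | j.+1 => if (j <= n)%N then merge j s else pinit s
  end.

Lemma coface_eq0 n i (a : DYnat C n) s :
  rend a (face i s) = 0 -> rend (coface i a) s = 0.
Proof.
case: i => [|i] /=; first by move=> E; rewrite rend_coface0 E tenm0.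
case: leqP => [le_in|lt_ni] E.
  by apply: (iso_epi (mergeR_iso i s)); rewrite rend_coface_merge // E compm0 comp0m.
by apply: (iso_epi (lastR_iso s)); rewrite rend_coface_last // E ten0m compm0 comp0m.
Qed.

End RightCochains.

(** * Cancellation in alternating sums *)

(** The bookkeeping of h d + d h at a tuple with first unit at [p]: the [x i] come from h d and the
    [y i] from d h. Terms below [p] cancel in pairs, those from [p.+2] on cancel with an index
    shift, [y p] cancels [y p.+1], and z - z + z remains. *)
Lemma alternating_sum_homotopy (k : fieldType) (V : lmodType k) (x y : nat -> V)
    (z : V) p N : (p.+2 <= N)%N ->
  (forall i, (i < p)%N -> y i = (-1) ^+ p.-1 *: x i) ->
  (forall i, (p.+2 <= i < N)%N -> y i = (-1) ^+ p *: x i.+1) ->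
  y p = y p.+1 -> x p = z -> x p.+1 = z -> x p.+2 = z ->
  (-1) ^+ p *: (\sum_(i < N.+1) (-1) ^+ i *: x i) +
    \sum_(i < N) (-1) ^+ i *: y i = z.
Proof.
move=> pN ylo yhi yp x0 x1 x2.
rewrite -(big_mkord xpredT (fun i => (-1) ^+ i *: x i)).
rewrite -(big_mkord xpredT (fun i => (-1) ^+ i *: y i)).
have pN1 : (p <= N)%N by apply: leq_trans pN; rewrite leqW.
rewrite (@big_cat_nat _ _ _ p) ?leqW //= (@big_cat_nat _ _ _ p 0 N) //=.
rewrite (@big_ltn _ _ _ p) ?ltnS // (@big_ltn _ _ _ p.+1) ?ltnS 1?ltnW //.
rewrite (@big_ltn _ _ _ p.+2) ?ltnS //.
rewrite (@big_ltn _ _ _ p N) 1?ltnW // (@big_ltn _ _ _ p.+1 N) //.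
rewrite x0 x1 x2 yp big_add1 /=.
have -> : \sum_(0 <= i < p) (-1) ^+ i *: y i =
    - ((-1) ^+ p *: \sum_(0 <= i < p) (-1) ^+ i *: x i).
  rewrite scaler_sumr -sumrN; apply: eq_big_nat => i /andP[_ ip].
  rewrite ylo // !scalerA -scaleNr mulrC; congr (_ *: _); rewrite -mulNr.
  (* The truncated predecessor in the sign is harmless: for [p = 0] the range of [i] is empty. *)
  by case: p {pN pN1 ylo yhi yp x0 x1 x2} ip => [|p] // _; rewrite exprS mulN1r opprK.
have -> : \sum_(p.+2 <= i < N) (-1) ^+ i *: y i =
    - ((-1) ^+ p *: \sum_(p.+2 <= i < N) (-1) ^+ i.+1 *: x i.+1).
  rewrite scaler_sumr -sumrN; apply: eq_big_nat => i ip.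
  rewrite yhi // !scalerA -scaleNr mulrC; congr (_ *: _).
  by rewrite exprS mulN1r mulrN opprK.
rewrite !exprS !mulN1r opprK !scaleNr !scalerDr.
rewrite scalerN !scalerA -!exprD addnn -muln2 mulnC exprM sqrrN expr1n.
by rewrite expr1n !scale1r addKr addNKr addrACA subrr add0r addrK.
Qed.

Lemma alternating_sum_cancel (k : fieldType) (V : lmodType k) (x : nat -> V) p N :
  (p.+2 <= N)%N ->
  (forall i, (i < p)%N -> x i = 0) ->
  (forall i, (p.+2 <= i < N)%N -> x i = 0) -> x p = x p.+1 ->
  \sum_(i < N) (-1) ^+ i *: x i = 0.
Proof.
move=> pN xlo xhi xp; rewrite -(big_mkord xpredT (fun i => (-1) ^+ i *: x i)).
rewrite (@big_cat_nat _ _ _ p) //=; last by apply: leq_trans pN; rewrite leqW.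
rewrite big_nat big1 ?add0r; last by move=> i /xlo ->; rewrite scaler0.
rewrite big_ltn 1?ltnW // big_ltn // [X in _ + (_ + X)]big_nat big1; last first.
  by move=> i /xhi ->; rewrite scaler0.
by rewrite addr0 xp exprS mulN1r scaleNr subrr.
Qed.

(** * Contraction of the cochains vanishing on nonunit tuples *)

Section Contraction.
Variables (k : fieldType) (U : ksemigroupal k) (I : U).
Hypothesis unitI : is_unit I.
Hypothesis nonunit_ten : forall X Y : U,
  ~ isomorphic X I -> ~ isomorphic Y I -> ~ isomorphic (X \ox Y) I.
Hypothesis unit_hom0l : forall (X : U) (f : hom I X), ~ isomorphic X I -> f = 0.
Hypothesis unit_hom0r : forall (X : U) (f : hom X I), ~ isomorphic X I -> f = 0.
Local Notation pos := (pos I).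
Local Notation ins := (ins I).
Local Notation insm := (insm unitI).

(** After deletion of the unit, both cofaces become [a] at the shortened tuple, by naturality of
    [a]; deletion is an isomorphism and can be cancelled. *)
Lemma coface_at n (a : DYnat U n) (s : pow U n.+2) p : (p <= n.+1)%N ->
  isomorphic (nth_obj p s) I -> rend (coface p a) s = rend (coface p.+1 a) s.
Proof.
move=> pn [e Ie]; apply: (iso_mono (delm_iso unitI Ie)).
transitivity (rend a (del p s) \c delm unitI e).
  case: p pn e Ie => [|p] pn e Ie.
    rewrite rend_coface0 /= -compA tenm_exchange compA.
    by rewrite -lam_nat -compA.
  have [f Ef] := delmS_mergeR unitI e pn.
  apply: (iso_epi (mergeR_iso p s)).
  rewrite -!compA rend_coface_merge // compA Ef.
  by rewrite -rend_nat.
(* If [p = n.+1], the unit is the last object and [coface p.+1] is the outer coface; otherwise it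
   merges the unit with its right neighbour. *)
symmetry; move: pn; rewrite leq_eqVlt ltnS => /orP[/eqP pn|pn]; last first.
  have [f Ef] := delm_mergeR unitI e pn.
  apply: (iso_epi (mergeR_iso p s)).
  rewrite -!compA rend_coface_merge // compA Ef.
  by rewrite -rend_nat.
subst p; have [f [e' Ef]] := delm_lastR unitI e.
apply: (iso_epi (lastR_iso s)).
rewrite -!compA rend_coface_last // compA Ef -compA -tenmM compm1 -rend_nat.
by rewrite compA rho_nat -compA -tenmM comp1m.
Qed.

Lemma hom0_unit_nonunit (X Y : U) (f : hom X Y) :
  isomorphic X I -> ~ isomorphic Y I -> f = 0.
Proof.
move=> [e Ie] nY; rewrite -[f]compm1 -(isoinvK Ie) compA.
by rewrite (unit_hom0l (f \c isoinv Ie) nY) comp0m.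
Qed.

Lemma hom0_nonunit_unit (X Y : U) (f : hom X Y) :
  ~ isomorphic X I -> isomorphic Y I -> f = 0.
Proof.
move=> nX [e Ie]; rewrite -[f]comp1m -(isoinvK Ie) -compA.
by rewrite (unit_hom0r (e \c f) nX) compm0.
Qed.

(** At the smaller of two different first unit positions, the component of [f] runs between a unit
    and a nonunit; it is zero, hence so is the tensor product. Naturality therefore only relates
    tuples with equal [pos]. *)
Lemma phom_pos n (s t : pow U n.+1) (f : phom s t) :
  pos s = pos t \/ tenRm f = 0.
Proof.
elim: n s t f => [|n IH] s t f.
  rewrite /=; case: asboolP => us; case: asboolP => ut; try by left.
    by right; exact: hom0_unit_nonunit.
  by right; exact: hom0_nonunit_unit.
rewrite [pos s]/= [pos t]/= [tenRm f]/=.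
case: (asboolP (isomorphic s.1 I)) => us; case: (asboolP (isomorphic t.1 I)) => ut;
  try by left.
- by right; rewrite (hom0_unit_nonunit f.1 us ut) ten0m.
- by right; rewrite (hom0_nonunit_unit f.1 us ut) ten0m.
case: (IH s.2 t.2 f.2) => E; first by (left; exact: (congr1 S E)).
by right; rewrite E tenm0.
Qed.

Lemma codegeneracy_ex p n (a : DYnat U n.+1) (s : pow U n.+1) :
  exists e : hom (tenR s) (tenR s), e \c insm p s = insm p s \c rend a (ins p s).
Proof.
exists (insm p s \c rend a (ins p s) \c isoinv (insm_iso unitI p s)).
by rewrite -compA isoinvK compm1.
Qed.

(* [a] with a unit inserted at position [p]. *)
Definition codegeneracy p n (a : DYnat U n.+1) (s : pow U n.+1) :
    hom (tenR s) (tenR s) :=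
  projT1 (cid (codegeneracy_ex p a s)).

Lemma codegeneracy_insm p n (a : DYnat U n.+1) (s : pow U n.+1) :
  codegeneracy p a s \c insm p s = insm p s \c rend a (ins p s).
Proof. by rewrite /codegeneracy; case: cid. Qed.

Lemma codegeneracy_eq p n (a : DYnat U n.+1) (s : pow U n.+1) e :
  e \c insm p s = insm p s \c rend a (ins p s) -> e = codegeneracy p a s.
Proof.
by move=> E; apply: (iso_epi (insm_iso unitI p s)); rewrite codegeneracy_insm.
Qed.

Lemma codegeneracy_nat p n (a : DYnat U n.+1) (s t : pow U n.+1) (f : phom s t) :
  codegeneracy p a t \c tenRm f = tenRm f \c codegeneracy p a s.
Proof.
apply: (iso_epi (insm_iso unitI p s)).
rewrite -!compA codegeneracy_insm insm_nat compA codegeneracy_insm (compA (tenRm f)).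
by rewrite insm_nat -!compA rend_nat.
Qed.

Lemma codegeneracy_diff p n (a : DYnat U n) (s : pow U n.+1) :
  codegeneracy p (DYdiff a) s =
  \sum_(i < n.+3) (-1) ^+ i *: codegeneracy p (coface i a) s.
Proof.
symmetry; apply: codegeneracy_eq; rewrite rend_diff comp_sumr comp_suml.
by apply: eq_bigr => i _; rewrite compZm compmZ codegeneracy_insm.
Qed.

(** Inserting at [pos s] doubles the first unit. A tuple without units has [pos s = n.+1], and there
    the value is set to zero. *)
Definition homotopy_fam n (a : DYnat U n.+1) (s : pow U n.+1) : hom (tenR s) (tenR s) :=
  if (pos s <= n)%N then (-1) ^+ pos s *: codegeneracy (pos s) a s else 0.

Lemma homotopy_fam_nat n (a : DYnat U n.+1) (s t : pow U n.+1) (f : phom s t) :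
  homotopy_fam a t \c tenRm f = tenRm f \c homotopy_fam a s.
Proof.
have [E|->] := phom_pos f; last by rewrite compm0 comp0m.
rewrite /homotopy_fam -E; case: ifP => _; last by rewrite compm0 comp0m.
by rewrite compZm compmZ codegeneracy_nat.
Qed.

Definition homotopy n (a : DYnat U n.+1) : DYnat U n := mkrend (@homotopy_fam_nat n a).

Lemma rend_homotopy n (a : DYnat U n.+1) s : (pos s <= n)%N ->
  rend (homotopy a) s = (-1) ^+ pos s *: codegeneracy (pos s) a s.
Proof. by move=> E; rewrite rend_mkrend /homotopy_fam E. Qed.

Lemma rend_homotopy0 n (a : DYnat U n.+1) s : pos s = n.+1 -> rend (homotopy a) s = 0.
Proof. by move=> E; rewrite rend_mkrend /homotopy_fam E ltnn. Qed.

(** The middle coface merges the inserted unit with the object after it, which [lam] undoes.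
    Positions [p] and [p.+1] of the enlarged tuple both hold units, so [coface_at] identifies the
    other two cofaces with the middle one. *)
Lemma codegeneracy_coface_at n (a : DYnat U n) s : (pos s <= n)%N ->
  let p := pos s in
  [/\ codegeneracy p (coface p a) s = rend a s,
      codegeneracy p (coface p.+1 a) s = rend a s
    & codegeneracy p (coface p.+2 a) s = rend a s].
Proof.
move=> pn p.
have E1 : codegeneracy p (coface p.+1 a) s = rend a s.
  symmetry; apply: codegeneracy_eq.
  have [f Ef] := ins_merge_at unitI s pn.
  apply: (iso_epi (mergeR_iso p (ins p s))); rewrite -!compA Ef.
  by rewrite rend_coface_merge // compA Ef rend_nat.
have I0 : isomorphic (nth_obj p (ins p s)) I.
  by rewrite at_ins //; exists (idm I); exact: iso_id.
split=> //; rewrite -E1; apply: codegeneracy_eq; rewrite codegeneracy_insm.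
  by rewrite (coface_at a _ I0) // leqW.
by rewrite (coface_at a _ (at_ins_pos _)) // ltnS.
Qed.

(** Common core of the next two lemmas. A merge before the first unit keeps its index and lowers the
    insertion point, so [j' = j] and [p = q.+1]; a merge after it has [j' = j.+1] and [p = q]. *)
Lemma coface_homotopy_merge n p q j j' (a : DYnat U n.+1) (s : pow U n.+2) :
    (j <= n)%N -> (j' <= n.+1)%N -> (q <= n)%N -> pos (merge j s) = q ->
    (exists f : phom (merge j' (ins p s)) (ins q (merge j s)),
      mergeR j s \c insm q (merge j s) \c tenRm f =
      insm p s \c mergeR j' (ins p s)) ->
  rend (coface j.+1 (homotopy a)) s = (-1) ^+ q *: codegeneracy p (coface j'.+1 a) s.
Proof.
move=> jn jn' qn posq [f Ef].
have I1 : is_iso (insm p s \c mergeR j' (ins p s)).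
  exact: iso_comp (insm_iso _ _ _) (mergeR_iso _ _).
apply: (iso_epi I1).
rewrite [RHS]compZm (compA (codegeneracy _ _ _)) codegeneracy_insm -(compA (insm p s)).
rewrite rend_coface_merge // (compA (insm p s)) -Ef.
rewrite !compA rend_coface_merge // rend_homotopy posq //.
rewrite compmZ !compZm; congr (_ *: _).
rewrite -(compA (mergeR j s)) codegeneracy_insm -!compA; do 2!congr (_ \c _).
by rewrite rend_nat.
Qed.

Lemma coface_homotopy_lt n (a : DYnat U n.+1) (s : pow U n.+2) i :
  (pos s <= n.+1)%N -> (i < pos s)%N ->
  rend (coface i (homotopy a)) s =
    (-1) ^+ (pos s).-1 *: codegeneracy (pos s) (coface i a) s.
Proof.
case: i => [|j] pn ip.
  have E : pos s = (pos (s.2 : pow U n.+1)).+1.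
    by move: ip; rewrite /=; case: asboolP.
  rewrite E succnK rend_coface0 rend_homotopy; last by rewrite -ltnS -E.
  rewrite tenm_idZ; congr (_ *: _); apply: codegeneracy_eq.
  rewrite rend_coface0 -[insm _.+1 s]/(idm s.1 \om insm _ (s.2 : pow U n.+1)).
  rewrite -!tenmMr; congr (_ \om _); exact: codegeneracy_insm.
case Ep : (pos s) pn ip => [|q] // pn ip.
have jn : (j <= n)%N by rewrite -ltnS ltnW //; exact: leq_trans ip pn.
have Eq : pos (merge j s) = q by rewrite pos_merge_lt ?Ep.
by apply: coface_homotopy_merge => //; [exact: leqW|exact: ins_merge_lt].
Qed.

Lemma coface_homotopy_gt n (a : DYnat U n.+1) (s : pow U n.+2) i :
  ((pos s).+2 <= i <= n.+2)%N ->
  rend (coface i (homotopy a)) s =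
    (-1) ^+ pos s *: codegeneracy (pos s) (coface i.+1 a) s.
Proof.
case: i => [|j] /andP[// pj jn]; rewrite ltnS in pj.
(* The case [j = n.+1] is the outer coface, which drops the last object instead of merging. *)
move: jn; rewrite ltnS leq_eqVlt ltnS => /orP[/eqP jn|jn]; last first.
  have Eq : pos (merge j s) = pos s by rewrite pos_merge_gt.
  apply: coface_homotopy_merge => //.
    by rewrite -ltnS; exact: leq_trans pj (leqW _).
  exact: ins_merge_gt.
subst j; rewrite ltnS in pj.
have [f [g E]] := ins_last unitI s pj.
have Ep : pos (pinit s) = pos s by rewrite pos_pinit; apply/minn_idPl; exact: leqW.
have I1 : is_iso (insm (pos s) s \c lastR (ins (pos s) s)).
  exact: iso_comp (insm_iso _ _ _) (lastR_iso _).
apply: (iso_epi I1).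
rewrite [RHS]compZm (compA (codegeneracy _ _ _)) codegeneracy_insm -(compA (insm _ s)).
rewrite rend_coface_last // (compA (insm _ s)) -E.
rewrite !compA rend_coface_last // rend_homotopy Ep //.
rewrite tenmZ_id compmZ !compZm; congr (_ *: _).
rewrite -!compA; congr (_ \c _); rewrite -!tenmM !comp1m !compm1.
by rewrite compA codegeneracy_insm -!compA rend_nat.
Qed.

Lemma pos_face_lt n (s : pow U n.+2) i : (i < pos s)%N ->
  pos (face i s) = (pos s).-1.
Proof.
case: i => [|j] js; first by move: js; rewrite /=; case: asboolP.
have jn : (j <= n)%N by rewrite -ltnS -ltnS; exact: leq_trans js (pos_le _ _).
by rewrite /face jn pos_merge_lt.
Qed.

Lemma pos_face_gt n (s : pow U n.+2) i : ((pos s).+2 <= i <= n.+2)%N ->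
  pos (face i s) = pos s.
Proof.
case: i => [|j] /andP[// pj jn]; rewrite ltnS in pj; rewrite /face.
case: leqP => jn'; first by rewrite pos_merge_gt.
rewrite pos_pinit; apply/minn_idPl.
exact: ltnW (leq_trans pj jn).
Qed.

Lemma pos_face_nonunit n (s : pow U n.+2) i : pos s = n.+2 -> (i <= n.+2)%N ->
  pos (face i s) = n.+1.
Proof.
move=> Ep; rewrite leq_eqVlt => /orP[/eqP->|ip].
  by rewrite /face ltnn pos_pinit Ep; apply/minn_idPr.
by rewrite pos_face_lt ?Ep.
Qed.

Lemma contraction n (a : DYnat U n.+1) :
  (forall s, pos s = n.+2 -> rend a s = 0) -> DYdiff a = 0 ->
  a = DYdiff (homotopy a).
Proof.
move=> a0 da; apply: rend_inj => s; rewrite rend_diff.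
have := pos_le I s; rewrite leq_eqVlt ltnS => /orP[/eqP pn|pn].
  (* Every face of a tuple without units has no units, and there the homotopy vanishes. *)
  rewrite a0 // big1 // => i _; rewrite coface_eq0 ?scaler0 // rend_homotopy0 //.
  by apply: pos_face_nonunit => //; rewrite -ltnS.
have [x0 x1 x2] := codegeneracy_coface_at a pn.
have Z : codegeneracy (pos s) (DYdiff a) s = 0.
  symmetry; apply: codegeneracy_eq; rewrite comp0m.
  rewrite (@rend_eq _ _ _ _ _ 0) ?compm0 //.
  by rewrite comp0m da.
(* The value of [a] is replaced by that of h d a + d h a; the first summand vanishes by [Z]. *)
rewrite -[LHS](@alternating_sum_homotopy _ _
  (fun i => codegeneracy (pos s) (coface i a) s)
  (fun i => rend (coface i (homotopy a)) s) (rend a s) (pos s) n.+3) //.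
- by rewrite -codegeneracy_diff Z scaler0 add0r.
- by move=> i; exact: coface_homotopy_lt.
- by move=> i; rewrite ltnS; exact: coface_homotopy_gt.
by rewrite (coface_at _ _ (at_pos _)).
Qed.

(** In lowest degree only h d is left. At a unit, the three terms of d a after doubling are a - a +
    a, so the cocycle condition forces [a] to vanish. *)
Lemma contraction0 (a : DYnat U 0) :
  (forall s, pos s = 1%N -> rend a s = 0) -> DYdiff a = 0 -> a = 0.
Proof.
move=> a0 da; apply: rend_inj => s; rewrite [RHS](@rend_eq _ _ _ _ _ 0) ?comp0m //.
have := pos_le I s; rewrite leq_eqVlt ltnS => /orP[/eqP pn|pn]; first exact: a0.
have [x0 x1 x2] := codegeneracy_coface_at a pn.
have Z : codegeneracy (pos s) (DYdiff a) s = 0.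
  symmetry; apply: codegeneracy_eq; rewrite comp0m.
  rewrite (@rend_eq _ _ _ _ _ 0) ?compm0 //.
  by rewrite comp0m da.
have p0 : pos s = 0%N by apply/eqP; rewrite -leqn0.
rewrite p0 in Z x0 x1 x2.
move: Z; rewrite codegeneracy_diff !big_ord_recl big_ord0 /= /bump /= x0 x1 x2.
by rewrite expr0 expr1 scaleN1r sqrrN expr1n scale1r addr0 addNr addr0.
Qed.

Definition normalized n (a : DYnat U n) : Prop :=
  forall s, (pos s <= n)%N -> rend a s = 0.

(** With first unit at [p], every face except [p] and [p.+1] still contains a unit, so its term
    vanishes; the two exceptional terms are equal by [coface_at] and have opposite signs. *)
Lemma normalized_diff n (a : DYnat U n) : normalized a -> normalized (DYdiff a).
Proof.
move=> a0 s pn; rewrite rend_diff.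
apply: (@alternating_sum_cancel _ _ (fun i => rend (coface i a) s) (pos s)) => //.
- move=> i ip; rewrite coface_eq0 // a0 // pos_face_lt // -ltnS prednK //.
  exact: leq_ltn_trans ip.
- move=> i; rewrite ltnS => ip; rewrite coface_eq0 // a0 // pos_face_gt //.
  by case/andP: ip => h1 h2; rewrite -ltnS -ltnS; exact: leq_trans h1 h2.
by rewrite (coface_at a pn) //; exact: at_pos.
Qed.

End Contraction.

(** * Extension by zero *)

Section Extension.
Variables (k : fieldType) (C : ksemigroupal k) (U : unitalization C).
Local Notation F := (uincl U).
Local Notation I := (uone U).
Local Notation pos := (pos I).
Local Notation res := (DYres_nat (@uincl_ff k C U)).

Lemma uincl_nonunit (X : C) : ~ isomorphic (F X) I.
Proof. by apply/uincl_image; exists X. Qed.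

Lemma unitalization_nonunit_ten (X Y : U) :
  ~ isomorphic X I -> ~ isomorphic Y I -> ~ isomorphic (X \ox Y) I.
Proof.
move=> /uincl_image[A <-] /uincl_image[B <-] J.
apply: (@uincl_nonunit (A \ox B)); apply: isomorphic_trans J.
exists (sgmi F A B), (sgm F A B); split; [exact: sgmiK|exact: sgmK].
Qed.

Lemma unitalization_hom0l (X : U) (f : hom I X) : ~ isomorphic X I -> f = 0.
Proof. by move=> /uincl_image[A E]; case: _ / E f; exact: uone_hom0l. Qed.

Lemma unitalization_hom0r (X : U) (f : hom X I) : ~ isomorphic X I -> f = 0.
Proof. by move=> /uincl_image[A E]; case: _ / E f; exact: uone_hom0r. Qed.

Lemma pos_pmap n (t : pow C n) : pos (pmap F t) = n.
Proof.
elim: n t => [//|n IH] t /=; rewrite IH; case: asboolP => // J.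
by case: (uincl_nonunit J).
Qed.

Lemma pmap_ex n (s : pow U n) : pos s = n -> exists t : pow C n, pmap F t = s.
Proof.
elim: n s => [|n IH] s /=; first by case: s; exists tt.
case: asboolP => // /uincl_image[A EA] [/IH[t Et]].
by exists (A, t); rewrite /= EA Et; case: s {EA Et}.
Qed.

Lemma pmapm_ex n (t t' : pow C n) (g : phom (pmap F t) (pmap F t')) :
  exists f : phom t t', pmapm F f = g.
Proof.
elim: n t t' g => [|n IH] t t' g; first by exists tt; case: g.
have [f Ef] := IH t.2 t'.2 g.2.
exists (ffinv (@uincl_ff k C U) g.1, f).
by rewrite /= ffinvK Ef; case: g {Ef}.
Qed.

Lemma sgR_iso n (t : pow C n.+1) : is_iso (sgR F t).
Proof.
elim: n t => [|n IH] t /=; first exact: iso_id.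
apply: iso_comp (iso_tenm (iso_id _) (IH _)).
by exists (sgmi F t.1 (@tenR C n t.2)); split; [exact: sgmK|exact: sgmiK].
Qed.

Lemma sgLi_iso n (t : pow C n.+1) : is_iso (sgLi F t).
Proof. by exists (sgL F t); split; [exact: sgLiK|exact: sgLK]. Qed.

Lemma push_ex n (a : DYnat C n) (t : pow C n.+1) :
  exists x : hom (@tenL U n (pmap F t)) (@tenR U n (pmap F t)),
  sgR F t \c x = fmap F (dyfam a t) \c sgL F t.
Proof.
exists (isoinv (sgR_iso t) \c (fmap F (dyfam a t) \c sgL F t)).
by rewrite compA isoinvKV comp1m.
Qed.

(* The image of [a] under the inclusion, up to [sgL] and [sgR]. *)
Definition push n (a : DYnat C n) (t : pow C n.+1) :
    hom (@tenL U n (pmap F t)) (@tenR U n (pmap F t)) :=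
  projT1 (cid (push_ex a t)).

Lemma pushE n (a : DYnat C n) (t : pow C n.+1) :
  sgR F t \c push a t = fmap F (dyfam a t) \c sgL F t.
Proof. by rewrite /push; case: cid. Qed.

Lemma push_nat n (a : DYnat C n) (t t' : pow C n.+1)
    (g : phom (pmap F t) (pmap F t')) :
  push a t' \c tenLm g = tenRm g \c push a t.
Proof.
have [f <-] := pmapm_ex g; apply: (iso_mono (sgR_iso t')).
apply: etrans (compA _ _ _) _; apply: etrans (congr1 (comp^~ _) (pushE a t')) _.
apply: etrans _ (esym (compA _ _ _)).
rewrite sgR_nat; apply: etrans _ (compA _ _ _).
apply: etrans _ (congr1 (comp _) (esym (pushE a t))).
by rewrite -compA sgL_nat !compA -!fmapM dynatP.
Qed.

(** On a tuple without units the value is described by its compatibility with all morphisms from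
    tuples [pmap F t]; this avoids transporting [push a t] along an equality of tuples. *)
Lemma ext_ex n (a : DYnat C n) (s : pow U n.+1) :
  exists x : hom (tenL s) (tenR s),
    (pos s = n.+1 -> forall t (f : phom (pmap F t) s),
       x \c tenLm f = tenRm f \c push a t) /\
    (pos s <> n.+1 -> x = 0).
Proof.
case: (pselect (pos s = n.+1)) => [E|N]; last by exists 0; split.
have [t Et] := pmap_ex E; case: _ / Et E => E.
by exists (push a t); split=> [_ t' f|//]; exact: push_nat.
Qed.

Definition ext_fam n (a : DYnat C n) : DYfam U n :=
  fun s => projT1 (cid (ext_ex a s)).

Lemma ext_famE n (a : DYnat C n) (s : pow U n.+1) t (f : phom (pmap F t) s) :
  pos s = n.+1 -> ext_fam a s \c tenLm f = tenRm f \c push a t.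
Proof.
by move=> Es; rewrite /ext_fam; case: (cid (ext_ex a s)) => x /= [Ex _]; exact: Ex.
Qed.

Lemma ext_fam0 n (a : DYnat C n) (s : pow U n.+1) :
  pos s <> n.+1 -> ext_fam a s = 0.
Proof. by rewrite /ext_fam; case: (cid (ext_ex a s)) => x []. Qed.

Lemma ext_fam_pmap n (a : DYnat C n) (t : pow C n.+1) :
  ext_fam a (pmap F t) = push a t.
Proof.
have := ext_famE a (pid (pmap F t)) (pos_pmap t).
by rewrite tenLm1 tenRm1 comp1m compm1.
Qed.

Lemma ext_natural n (a : DYnat C n) : ext_fam a \in @DYnatb k U n.
Proof.
apply/asboolP => s t f.
have [E|E] := phom_pos unitalization_hom0l unitalization_hom0r f; last first.
  (* [phom_pos] concerns the right bracketing; conjugation by [rebracket] makes the left-bracketed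
     product zero as well. *)
  rewrite E comp0m (_ : tenLm f = 0) ?compm0 //.
  by apply: (iso_mono (rebracket_iso t)); rewrite rebracket_nat E comp0m compm0.
case: (pselect (pos s = n.+1)) => [Es|Ns]; last first.
  by rewrite !ext_fam0 -?E // comp0m compm0.
have Et : pos t = n.+1 by rewrite -E.
have [s' Es'] := pmap_ex Es; case: _ / Es' f E Es => f _ _.
by rewrite ext_famE // ext_fam_pmap.
Qed.

Definition ext n (a : DYnat C n) : DYnat U n := MkDYnat (ext_natural a).

Lemma ext_normalized n (a : DYnat C n) : normalized I (ext a).
Proof.
move=> s ps; apply: rend_eq; rewrite comp0m /= ext_fam0 // => E.
by rewrite E ltnn in ps.
Qed.

Lemma fmap_res n (b : DYnat U n) (t : pow C n.+1) :
  fmap F (dyfam (res b) t) = sgR F t \c dyfam b (pmap F t) \c sgLi F t.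
Proof. exact: ffinvK. Qed.

Lemma res_ext n (a : DYnat C n) : res (ext a) = a.
Proof.
apply: dynat_inj => t; apply: (ff_inj (@uincl_ff k C U)).
by rewrite fmap_res /= ext_fam_pmap pushE -compA sgLiK compm1.
Qed.

Lemma fmap_uincl0 (X Y : C) : fmap F (0 : hom X Y) = 0.
Proof.
have /= := @uincl_linear k C U X Y (-1) 0 0.
by rewrite !scaleN1r oppr0 addr0 addNr.
Qed.

Lemma res_eq0 n (b : DYnat U n) s : res b = 0 -> pos s = n.+1 -> rend b s = 0.
Proof.
move=> b0 /pmap_ex[t <-]; apply: rend_eq; rewrite comp0m; symmetry.
apply: (iso_mono (sgR_iso t)); apply: (iso_epi (sgLi_iso t)).
rewrite -fmap_res b0 compm0 comp0m; exact: fmap_uincl0.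
Qed.

(** Tuples containing a unit are covered by normalization, all others come from [C]. This reduces
    identities between extended cochains to identities on [C]. *)
Lemma normalized_res_eq0 n (b : DYnat U n) :
  normalized I b -> res b = 0 -> b = 0.
Proof.
move=> nb rb; apply: rend_inj => s; rewrite [RHS](@rend_eq _ _ _ _ _ 0) ?comp0m //.
have := pos_le I s; rewrite leq_eqVlt ltnS => /orP[/eqP E|]; last exact: nb.
exact: res_eq0.
Qed.

Lemma res0 n : res (0 : DYnat U n) = 0.
Proof. exact: (linear0 (DYres (@uincl_linear k C U) (@uincl_ff k C U) n.+1)). Qed.

Lemma resB n (a b : DYnat U n) : res (a - b) = res a - res b.
Proof. exact: (linearB (DYres (@uincl_linear k C U) (@uincl_ff k C U) n.+1)). Qed.

Lemma res_diff n (b : DYnat U n) : res (DYdiff b) = DYdiff (res b).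
Proof. exact: DYres_diff (@uincl_linear k C U) _ _ _. Qed.

Lemma ext_cocycle n (a : DYnat C n) :
  DYdiff a = 0 -> DYdiff (ext a) = 0.
Proof.
move=> da; apply: normalized_res_eq0; last by rewrite res_diff res_ext.
exact: normalized_diff (uone_unit U) unitalization_nonunit_ten _ _ (@ext_normalized _ a).
Qed.

Lemma res_coboundary0 (z : DYnat U 0) : DYdiff z = 0 -> res z = 0 -> z = 0.
Proof.
move=> dz rz; apply: (contraction0 (uone_unit U)) => // s; exact: res_eq0.
Qed.

(** Subtracting the coboundary of [ext y] from [z] leaves a cocycle that vanishes on [C], to which
    the contraction applies. *)
Lemma res_coboundary n (z : DYnat U n.+1) (y : DYnat C n) :
  DYdiff z = 0 -> res z = DYdiff y -> exists x, z = DYdiff x.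
Proof.
move=> dz rz.
(* The cochain d d ([ext y]) is normalized, and its restriction d d y equals the restriction of d z,
   which is zero. *)
have db : DYdiff (DYdiff (ext y)) = 0.
  apply: normalized_res_eq0.
    do 2!apply: (normalized_diff (uone_unit U) unitalization_nonunit_ten).
    exact: ext_normalized.
  by rewrite !res_diff res_ext -rz -res_diff dz res0.
have dw : DYdiff (z - DYdiff (ext y)) = 0 by rewrite linearB /= dz db subrr.
have := contraction (uone_unit U) unitalization_nonunit_ten
  unitalization_hom0l unitalization_hom0r _ dw.
set h := homotopy _ _ _ _ => E; exists (ext y + h).
rewrite linearD /= -E; first by rewrite addrC subrK.
move=> s; apply: res_eq0.
by rewrite resB res_diff res_ext rz subrr.
Qed.

End Extension.

(** * The isomorphism on cohomology *)

Lemma inj_surj_bijective (A B : choiceType) (f : A -> B) :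
  injective f -> (forall y, exists x, f x = y) -> bijective f.
Proof.
move=> finj fsurj; have ex y : exists x, f x == y.
  by have [x <-] := fsurj y; exists x.
have gK y : f (xchoose (ex y)) = y by exact/eqP/(xchooseP (ex y)).
by exists (fun y => xchoose (ex y)) => [x|y //]; apply: finj.
Qed.

Theorem theorem1 (k : fieldType) (C : ksemigroupal k) (U : unitalization C)
    (hC : equiv_to_strict_skeletal C) (n : nat) (hn : (1 <= n)%N) :
  bijective (DYH_restr U n).
Proof.
(* Surjectivity comes first: a class is hit by the extension by zero of a representing cocycle. *)
case: n hn => // n _; apply: inj_surj_bijective; last first.
  elim/lmod_piW => -[z zP]; have /eqP dz := zP.
  have bP : ext U z \in @cocycleb _ _ (@DYd k U) n.+1.
    by apply/eqP; exact: ext_cocycle.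
  exists (coclass (@MkCocycle k (DYC U) (@DYd k U) n.+1 (ext U z) bP)).
  rewrite /DYH_restr /= cohomology_mapE; congr coclass; apply: val_inj.
  exact: res_ext.
(* By linearity, injectivity reduces to a trivial kernel. *)
move=> x1 x2 E; apply/eqP; rewrite -subr_eq0; apply/eqP.
have : DYH_restr U n.+1 (x1 - x2) = 0 by rewrite linearB /= E subrr.
elim/lmod_piW: (x1 - x2) => -[z zP]; have /eqP dz := zP.
rewrite /DYH_restr /= cohomology_mapE -(linear0 (lmod_pi _)).
move=> /lmod_piP; rewrite subr0 => /asboolP Bz.
rewrite -(linear0 (lmod_pi _)); apply/lmod_piP; rewrite subr0; apply/asboolP.
(* In degree 1 the only coboundary is zero, so the cocycle itself must vanish; in higher degrees a
   primitive has to be found. *)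
case: n z zP dz Bz {x1 x2 E} => [|n] z zP dz [y /= rz].
  by exists 0; rewrite /=; exact: res_coboundary0 rz.
exact: res_coboundary rz.
Qed.
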